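(* Let $z\in(0,1-1/\sqrt2)$, let $M$ be a positive number and let $a,b,c$ be nonnegative numbers with $a>0$; put $\tau=4(2+cz)/(az^2)$. Let $\{\Delta_m,\ m\in\mathcal M\}$ be nonnegative numbers such that $\Sigma=\sum_{m\in\mathcal M}e^{-\Delta_m}<+\infty$ and $\Delta_m\ge1$ for all $m\in\mathcal M$. Assume that for all $y,\xi>0$, $$\sup_{t,t'\in\mathcal B(s,y)}\mathbb P[Z(N,t,t')>\xi]\le b\exp\left[-\frac{a\xi^2}{y^2+c\xi}\right],$$ and that for each $m\in\mathcal M$, $\mathcal S_m$ is an $(M,\eta_m\sqrt\tau,D_m)$-net for $S_m$ with $\eta_m^2=2(D_m\vee1/8)$. Let $\mathcal S=\bigcup_{m\in\mathcal M}\mathcal S_m$ and $$\mathrm{pen}(t)=z\tau\inf_{m\in\mathcal M(t)}\left(4\eta_m^2+\Delta_m\right)\quad\text{for all }t\in\mathcal S,\qquad\text{where }\mathcal M(t)=\{m\in\mathcal M:\ t\in S_m\}.$$ Then the estimator $\tilde s=\hat s_{\hat\lambda}$ obtained by the indirect selection procedure (described in the context) satisfies $$\mathbb E[H^2(s,\tilde s)]\le C\inf_{\lambda\in\Lambda}\left\{\mathbb E[H^2(s,\hat s_\lambda)]+\tau\,\mathbb E\left[D_{\hat m(\lambda)}\vee\Delta_{\hat m(\lambda)}\right]\right\},$$ where $C$ is a constant depending on $z,M$ and $\Sigma$ only.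
   Context: Setting. $N_1,\dots,N_k$ are independent random measures on a probability space $(\Omega,\mathcal T,\mathbb P)$, $N_i$ taking values in the positive measures on a measured space $(\mathcal X_i,\mathcal A_i,\mu_i)$, with $\mathbb E[N_i(A)]=\int_A s_i\,d\mu_i<+\infty$ for all $A\in\mathcal A_i$, where $s_i\ge0$ is measurable. Write $N=(N_1,\dots,N_k)$, $s=(s_1,\dots,s_k)$, $\mu=(\mu_1,\dots,\mu_k)$. $\mathcal L$ is the set of $k$-tuples $t=(t_1,\dots,t_k)$ of nonnegative measurable functions with $t_i$ integrable on $(\mathcal X_i,\mathcal A_i,\mu_i)$; $\mathcal L_0\subset\mathcal L$ is a known subset containing $s$. All operations on $k$-tuples are componentwise, and $\int_{\mathcal X}f\,d\nu=\sum_{i=1}^k\int_{\mathcal X_i}f_i\,d\nu_i$. The loss is $H^2(t,t')=\frac12\int_{\mathcal X}(\sqrt t-\sqrt{t'})^2d\mu$ and $\mathcal B(t,y)=\{t'\in\mathcal L_0:H(t,t')\le y\}$. Notation. $\rho(t,t')=\int_{\mathcal X}\sqrt{tt'}\,d\mu$, $\rho_r(\nu,t)=\frac12\left[\rho(t,r)+\int_{\mathcal X}\sqrt{t/r}\,d\nu\right]$ (conventions $0/0=0$, $a/0=+\infty$ for $a>0$). $Z(N,t,t')=\int_{\mathcal X}\psi(t,t',x)\,dN-\int_{\mathcal X}\psi(t,t',x)\,s\,d\mu$, where (componentwise) $\psi(t,t',x)=\frac1{\sqrt2}\left[\sqrt{\frac1{1+t(x)/t'(x)}}-\sqrt{\frac1{1+t'(x)/t(x)}}\right]$.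 Nets. For $S\subset\mathcal L_0$, $\varepsilon>0$ and nonnegative numbers $M,D$, a set $\mathcal S\subset S$ is an $(M,\varepsilon,D)$-net for $S$ if for every $t\in S$ there is $t'\in\mathcal S$ with $H(t,t')\le\varepsilon$, and for all $s'\in\mathcal L_0$ and $r\ge2\varepsilon$, $|\{t\in\mathcal S:\ H(s',t)\le r\}|\le M\exp[D(r/\varepsilon)^2]$. Models and estimators. $\{S_m,\ m\in\mathcal M\}$ is an at most countable family of nonvoid subsets of $\mathcal L_0$, $\mathbb S=\bigcup_mS_m$; $\{\hat s_\lambda,\lambda\in\Lambda\}$ is an at most countable family of estimators (measurable functions of $N$) with values in $\mathbb S$; $\hat m(\lambda)$ is a (possibly random, depending on $N$) element of $\mathcal M(\hat s_\lambda)=\{m\in\mathcal M:\hat s_\lambda\in S_m\}$. For $t\in\mathbb S$, $A(t,\mathcal S)=\inf_{t'\in\mathcal S}[H^2(t,t')+\mathrm{pen}(t')]$. Direct selection procedure, for a family $\{\tilde s_\lambda,\lambda\in\Lambda\}$ of estimators with values in $\mathcal S$. For $\tilde s_\lambda\ne\tilde s_{\lambda'}$ put, with $r=(\tilde s_\lambda+\tilde s_{\lambda'})/2$, $$\mathbf T(N,\tilde s_\lambda,\tilde s_{\lambda'})=\left[\rho_r(N,\tilde s_{\lambda'})-\tfrac12\int_{\mathcal X}\tilde s_{\lambda'}d\mu-\mathrm{pen}(\tilde s_{\lambda'})\right]-\left[\rho_r(N,\tilde s_\lambda)-\tfrac12\int_{\mathcal X}\tilde s_\lambda d\mu-\mathrm{pen}(\tilde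 s_\lambda)\right].$$ Let $\mathcal E(\tilde s_\lambda)$ be the set of those $\tilde s_{\lambda'}\neq\tilde s_\lambda$ with $\mathbf T(N,\tilde s_\lambda,\tilde s_{\lambda'})\ge0$, and $\mathcal D(\tilde s_\lambda)=\sup\{H^2(\tilde s_\lambda,\tilde s_{\lambda'}):\tilde s_{\lambda'}\in\mathcal E(\tilde s_\lambda)\}$ ($=0$ if $\mathcal E(\tilde s_\lambda)=\varnothing$). Select any $\tilde\lambda\in\Lambda$ with $\mathcal D(\tilde s_{\tilde\lambda})\le\mathcal D(\tilde s_\lambda)+\tau$ for all $\lambda\in\Lambda$. Indirect selection procedure. To each $\lambda\in\Lambda$ associate $\tilde s_\lambda$, any element of $\mathcal S$ with $H^2(\hat s_\lambda,\tilde s_\lambda)+\mathrm{pen}(\tilde s_\lambda)\le A(\hat s_\lambda,\mathcal S)+\tau$. Select $\tilde\lambda$ by the direct selection procedure applied to $\{\tilde s_\lambda,\lambda\in\Lambda\}$. Finally $\hat\lambda$ is any element of $\Lambda$ such that $H^2(\hat s_{\hat\lambda},\tilde s_{\tilde\lambda})\le\inf_{\lambda\in\Lambda}H^2(\hat s_\lambda,\tilde s_{\tilde\lambda})+\tau$.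
   Formalization: Two corrections to a false statement: the constant C may depend on b as well as on z, M and Σ; and in pen(t) the infimum runs over those m whose net (not whose model S_m) contains t. *)

(* Defs.v *)
From HB Require Import structures.
From mathcomp Require Export all_boot all_order all_algebra.
From mathcomp Require Export all_classical all_reals all_analysis.
From mathcomp Require Export measurable_realfun.

Set Implicit Arguments.
Unset Strict Implicit.
Unset Printing Implicit Defensive.

Import Order.TTheory GRing.Theory Num.Theory.

Local Open Scope classical_set_scope.
Local Open Scope ring_scope.

Definition ftuple (R : realType) (k : nat) (d : 'I_k -> measure_display)
    (X : forall i, measurableType (d i)) : Type := forall i, X i -> R.

Definition mtuple (R : realType) (k : nat) (d : 'I_k -> measure_display)
    (X : forall i, measurableType (d i)) : Type :=
  forall i, {measure set (X i) -> \bar R}.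

Section hellinger.
Context (R : realType) (k : nat) (d : 'I_k -> measure_display).
Context (X : forall i, measurableType (d i)).
Local Open Scope ereal_scope.

(* The class of k-tuples of nonnegative, measurable, integrable functions.
   Its elements are functions, not classes modulo mu-null sets. *)
Definition tuple_class (mu : mtuple R X) : set (ftuple R X) :=
  [set t : ftuple R X | forall i, [/\ measurable_fun [set: X i] (t i),
                         (forall x, (0 <= t i x)%R) &
                         (mu i).-integrable [set: X i] (EFin \o t i)]].

Definition tint (nu : mtuple R X) (f : forall i, X i -> \bar R) : \bar R :=
  \sum_(i < k) \int[nu i]_x f i x.

Definition H2 (mu : mtuple R X) (t t' : ftuple R X) : \bar R :=
  (2^-1)%:E * tint mu (fun i x =>
    ((Num.sqrt (t i x) - Num.sqrt (t' i x)) ^+ 2)%:E).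

Definition hell (mu : mtuple R X) (t t' : ftuple R X) : \bar R := sqrte (H2 mu t t').

Definition rho (mu : mtuple R X) (t t' : ftuple R X) : \bar R :=
  tint mu (fun i x => (Num.sqrt (t i x * t' i x))%:E).

(* Ratios are taken in [\bar R], where 0 / 0 = 0 and a / 0 = +oo if a > 0. *)
Definition rhor (mu : mtuple R X) (r : ftuple R X) (nu : mtuple R X)
    (t : ftuple R X) : \bar R :=
  (2^-1)%:E *
  (rho mu t r + tint nu (fun i x => sqrte ((t i x)%:E / (r i x)%:E))).

Definition psi (t t' : ftuple R X) : forall i, X i -> \bar R := fun i x =>
  ((Num.sqrt 2)^-1)%:E *
  (sqrte ((1 + (t i x)%:E / (t' i x)%:E)^-1) -
   sqrte ((1 + (t' i x)%:E / (t i x)%:E)^-1)).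

(* [Zstat mu s nu t t'] is the statistic Z(nu, t, t') when the intensity of
   the underlying random measure is s with respect to mu. *)
Definition Zstat (mu : mtuple R X) (s : ftuple R X) (nu : mtuple R X)
    (t t' : ftuple R X) : \bar R :=
  tint nu (psi t t') - tint mu (fun i x => psi t t' x * (s i x)%:E).

Definition hball (mu : mtuple R X) (L0 : set (ftuple R X)) (t : ftuple R X)
    (y : R) : set (ftuple R X) :=
  [set t' | L0 t' /\ hell mu t t' <= y%:E].

(* The cardinality bound also asserts that the set in question is finite. *)
Definition is_net (mu : mtuple R X) (L0 : set (ftuple R X)) (M eps D : R)
    (net S : set (ftuple R X)) : Prop :=
  [/\ net `<=` S,
      forall t, S t -> exists2 t', net t' & hell mu t t' <= eps%:E &
      forall s' (r : R), L0 s' -> (2 * eps <= r)%R ->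
        exists n : nat,
          ([set t | net t /\ hell mu s' t <= r%:E] #<= `I_n)%card /\
          (n%:R <= M * expR (D * (r / eps) ^+ 2))%R].

End hellinger.

Section random_measures.
Context (R : realType) (k : nat) (d : 'I_k -> measure_display).
Context (X : forall i, measurableType (d i)).

(* The sigma-algebra on measures generated by the evaluations nu |-> nu A. *)
Definition measure_sigma (i : 'I_k) : set (set {measure set (X i) -> \bar R}) :=
  <<s [set E : set {measure set (X i) -> \bar R} |
        exists (A : set (X i)) (B : set (\bar R)),
          [/\ measurable A, measurable B & E = [set nu | B (nu A)]]] >>.

Definition mtuple_sigma : set (set (mtuple R X)) :=
  <<s [set E : set (mtuple R X) |
        exists i (A : set (X i)) (B : set (\bar R)),
          [/\ measurable A, measurable B & E = [set nu | B (nu i A)]]] >>.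

Context (dO : measure_display) (Omega : measurableType dO).
Variable P : probability Omega R.
Variable N : forall i, R.-ker Omega ~> X i.

(* Since every measure_sigma i contains the whole space, the product rule over
   all indices contains the product rule over every subfamily. *)
Definition independent_measures : Prop :=
  forall E : forall i, set {measure set (X i) -> \bar R},
    (forall i, measure_sigma (E i)) ->
    P [set w | forall i, E i (N i w)] =
    (\prod_(i < k) P [set w | E i (N i w)])%E.

Definition has_intensity (mu : mtuple R X) (s : ftuple R X) : Prop :=
  forall i (A : set (X i)), measurable A ->
    (\int[P]_w N i w A = \int[mu i]_(x in A) (s i x)%:E /\
     \int[P]_w N i w A < +oo)%E.

Definition obs (w : Omega) : mtuple R X := fun i => N i w.

End random_measures.

Section selection.
Context (R : realType) (k : nat) (d : 'I_k -> measure_display).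
Context (X : forall i, measurableType (d i)).
Variables (mu : mtuple R X).

(* L0 carries the sigma-algebra generated by the Hellinger balls, the smallest
   one making all the losses H(t, .), t in L0, measurable. *)
Definition is_estimator (L0 : set (ftuple R X))
    (shat : mtuple R X -> ftuple R X) : Prop :=
  forall A, <<s [set B | exists t (y : R), L0 t /\ B = hball mu L0 t y] >> A ->
    mtuple_sigma (shat @^-1` A).

Context (L : Type).
Variables (pen : ftuple R X -> R) (tau : R) (N : mtuple R X).
Local Open Scope ereal_scope.

Definition Tstat (t t' : ftuple R X) : \bar R :=
  let r : ftuple R X := fun i x => ((t i x + t' i x) / 2)%R in
  let crit (u : ftuple R X) :=
    rhor mu r N u - (2^-1)%:E * tint mu (fun i x => (u i x)%:E) - (pen u)%:E in
  crit t' - crit t.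

Definition Eset (st : L -> ftuple R X) (t : ftuple R X) : set (ftuple R X) :=
  [set t' | [/\ range st t', t' <> t & 0 <= Tstat t t']].

(* The maximum with 0 only matters when Eset is empty, as H2 >= 0. *)
Definition Dcrit (st : L -> ftuple R X) (t : ftuple R X) : \bar R :=
  maxe 0 (ereal_sup [set H2 mu t t' | t' in Eset st t]).

Definition direct_selected (st : L -> ftuple R X) (lt : L) : Prop :=
  forall l, Dcrit st (st lt) <= Dcrit st (st l) + tau%:E.

Definition Aapprox (net : set (ftuple R X)) (t : ftuple R X) : \bar R :=
  ereal_inf [set H2 mu t t' + (pen t')%:E | t' in net].

(* [lh] is a possible output, on the observation N, of the indirect procedure
   applied to the family [sh] of estimates: st and lt are the intermediate
   choices, which are otherwise arbitrary. *)
Definition indirect_selected (net : set (ftuple R X))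
    (sh : L -> ftuple R X) (lh : L) : Prop :=
  exists (st : L -> ftuple R X) (lt : L),
    [/\ forall l, net (st l) /\
          H2 mu (sh l) (st l) + (pen (st l))%:E <=
          Aapprox net (sh l) + tau%:E,
        direct_selected st lt &
        H2 mu (sh lh) (st lt) <=
        ereal_inf [set H2 mu (sh l) (st lt) | l in [set: L]] + tau%:E].

End selection.

Definition tau_of (R : realType) (z a c : R) : R :=
  4 * (2 + c * z) / (a * z ^+ 2).

Definition eta_of (R : realType) (D : R) : R :=
  Num.sqrt (2 * Num.max D (8^-1)).

(* The infimum runs over the indices m of the nets [net m] containing t: it is
   only for those m that the cardinality bound of [is_net] says something
   about t. *)
Definition net_pen (R : realType) (k : nat) (d : 'I_k -> measure_display)
    (X : forall i, measurableType (d i)) (I : Type) (z tau : R)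
    (net : I -> set (ftuple R X)) (D Delta : I -> R) (t : ftuple R X) : R :=
  z * tau *
  inf [set 4 * eta_of (D m) ^+ 2 + Delta m | m in [set m | net m t]].

(* Main.v *)
Require Import Defs.
From HB Require Import structures.
From mathcomp Require Import all_boot all_order all_algebra.
From mathcomp Require Import all_classical all_reals all_analysis.
From mathcomp Require Import measurable_realfun.
From mathcomp Require Import ring lra.

Import Order.TTheory GRing.Theory Num.Theory.
Import numFieldNormedType.Exports.

Local Open Scope classical_set_scope.
Local Open Scope ring_scope.

(** The idea is to compare two candidate intensities [t] and [u] through the
    midpoint [r = (t + u) / 2]. For [f = t] or [u], the integral of
    [(sqrt (f r) + s sqrt (f / r)) / 2] overestimates the Hellinger affinity
    of [f] and [s], and it can be estimated without bias by replacing [s] with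
    the observation. The difference of the two criteria is therefore at most
      (1 + 1 / sqrt 2) H2 s t - (1 - 1 / sqrt 2) H2 s u + Z t u
    up to penalties (Tstat_ge0_Zreal), where Z is the centred statistic whose
    tails are controlled by hypothesis. So [u] is preferred to [t] only when
    it is almost as close to [s] as [t] is, or when Z is large.

    Z is controlled uniformly over pairs of points of the nets. Pairs are
    sorted into shells according to [H2 s t + H2 s u]; in each shell the
    cardinality bound on the nets is beaten by the exponential tail, and what
    is left over is a product of summable weights (shell_event_le). Outside an
    event of probability O(exp (- n)), for all pairs,
      Z t u <= z (H2 s t + H2 s u) + pen t + pen u + z tau n
    (exceptional_le, not_exceptional_Zreal). As z < 1 - 1 / sqrt 2, the terms
    in [H2 s u] can be absorbed, and [pen u] cancels with the penalty in the
    criterion: the loss of anything preferred to [t] is at most a constant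
    times [H2 s t + pen t + tau n].

    From there on the argument is deterministic. Of two candidates one is
    always preferred to the other, so the selection criterion bounds the
    distance from the selected point to every competitor, and the net
    approximating an estimator in the model [mhat l] bounds its penalised
    approximation error by a constant times [tau * max D Delta]
    (indirect_selected_oracle). The resulting inequality holds pointwise with
    a remainder [tau n], where [n] can be taken at most equal to the number
    of exceptional events that occur; the expectation of this number is finite,
    and is absorbed using [Delta >= 1]. *)

(** * Pointwise inequalities *)

Section pointwise.
Context {R : realType}.
Implicit Types x y u v s t : R.

Definition testfun (t t' r : R) : R :=
  (Num.sqrt (t' / r) - Num.sqrt (t / r)) / 2.

Lemma sqrtr_mid_concave t t' : 0 <= t -> 0 <= t' ->
  Num.sqrt t + Num.sqrt t' <= 2 * Num.sqrt ((t + t') / 2).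
Proof.
move=> t0 t0'; set r := (t + t') / 2.
have r0 : 0 <= r by rewrite divr_ge0// addr_ge0.
rewrite -ler_sqr ?nnegrE ?addr_ge0 ?mulr_ge0 ?sqrtr_ge0//.
have := sqr_sqrtr t0; have := sqr_sqrtr t0'; have := sqr_sqrtr r0.
move: (Num.sqrt t) (Num.sqrt t') (Num.sqrt r) => a b c hc hb ha.
have : 0 <= (a - b) ^+ 2 by apply: sqr_ge0.
rewrite exprMn hc /r -ha -hb => h; nra.
Qed.

Lemma sqrtr_div_mid_le2 t t' : 0 <= t -> 0 <= t' ->
  Num.sqrt (t' / ((t + t') / 2)) <= Num.sqrt 2.
Proof.
move=> t0 t0'; rewrite ler_wsqrtr//.
have [r0|r0] := eqVneq ((t + t') / 2) 0.
  by rewrite r0 invr0 mulr0.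
have rgt : 0 < (t + t') / 2 by rewrite lt_neqAle eq_sym r0 divr_ge0// addr_ge0.
by rewrite ler_pdivrMr// [leRHS]mulrC divfK// lerDr.
Qed.

(** Since [r = (t + t') / 2], for [w = t] or [t'] the expression
    [(s + r) sqrt (w / r) / 2] equals
    [sqrt (s w) + sqrt (w / r) (sqrt s - sqrt r) ^ 2 / 2]. The last term is
    dropped for [w = t]. For [w = t'] it is bounded by means of
    [sqrt (t' / r) <= sqrt 2] and of the convexity of
    [r |-> (sqrt s - sqrt r) ^ 2]. *)
Lemma test_drift_le s t t' r : 0 <= s -> 0 <= t -> 0 <= t' ->
  r = (t + t') / 2 ->
  testfun t t' r * s + (Num.sqrt (t' * r) - Num.sqrt (t * r)) / 2
    + (t - t') / 2 <=
  (1 + (Num.sqrt 2)^-1) * ((Num.sqrt s - Num.sqrt t) ^+ 2 / 2)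
  - (1 - (Num.sqrt 2)^-1) * ((Num.sqrt s - Num.sqrt t') ^+ 2 / 2).
Proof.
move=> s0 t0 t0' rdef; rewrite /testfun.
have r0 : 0 <= r by rewrite rdef divr_ge0// addr_ge0.
have r20 : 0 < Num.sqrt 2 :> R by rewrite sqrtr_gt0.
have hconc := sqrtr_mid_concave t t' t0 t0'; rewrite -rdef in hconc.
have hle2 := sqrtr_div_mid_le2 t t' t0 t0'; rewrite -rdef in hle2.
have divE (w : R) : 0 <= w -> w <= 2 * r ->
    exists2 a : R, 0 <= a & [/\ Num.sqrt (w / r) = a, Num.sqrt w = a * Num.sqrt r &
      Num.sqrt (w * r) = a * r].
  move=> w0 wr; exists (Num.sqrt (w / r)); first exact: sqrtr_ge0.
  have [rE|rN] := eqVneq r 0.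
    have -> : w = 0 by apply/le_anti; rewrite w0 andbT (le_trans wr)// rE mulr0.
    by rewrite !mul0r sqrtr0 !mul0r.
  have wE : w = w / r * r by rewrite divfK.
  split=> //.
    by rewrite {1}wE sqrtrM// divr_ge0.
  rewrite {1}wE -mulrA sqrtrM ?divr_ge0//; congr (_ * _).
  by rewrite -expr2 sqrtr_sqr ger0_norm.
have tr : t <= 2 * r by rewrite rdef mulrC divfK// lerDl.
have tr' : t' <= 2 * r by rewrite rdef mulrC divfK// lerDr.
have [a a0 [-> st ->]] := divE t t0 tr.
have [a' a0' [aE st' ->]] := divE t' t0' tr'.
rewrite aE in hle2 *.
have := sqr_sqrtr t0; have := sqr_sqrtr t0'; have := sqr_sqrtr r0.
have := sqr_sqrtr s0.
have h2 : Num.sqrt 2 ^+ 2 = 2 :> R by rewrite sqr_sqrtr.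
rewrite st st' in hconc *.
have := sqrtr_ge0 s; have := sqrtr_ge0 r.
have hi : (Num.sqrt 2)^-1 = Num.sqrt 2 / 2 :> R.
  apply: (mulfI (lt0r_neq0 r20)).
  by rewrite mulrA -expr2 h2 !divff// ?lt0r_neq0.
rewrite hi.
move: (Num.sqrt 2) (Num.sqrt s) (Num.sqrt r) h2 r20 hle2 hconc {hi}.
move=> q S c h2 r20 hle2 hconc c0 S0 sE rE tE' tE.
have -> : r = c ^+ 2 by [].
rewrite -sE -tE -tE'.
have key : a' * (S - c) ^+ 2 <= q * ((S - a * c) ^+ 2 + (S - a' * c) ^+ 2) / 2.
  apply: (@le_trans _ _ (q * (S - c) ^+ 2)).
    by rewrite ler_wpM2r// sqr_ge0.
  rewrite -mulrA ler_wpM2l ?(ltW r20)//.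
  have rr : c ^+ 2 * 2 = (a * c) ^+ 2 + (a' * c) ^+ 2.
    by rewrite rE tE tE' rdef mulrC; field.
  have : S * (a * c + a' * c) <= S * (2 * c) by rewrite ler_wpM2l.
  nra.
have ka : 0 <= a * (S - c) ^+ 2 by rewrite mulr_ge0// sqr_ge0.
nra.
Qed.

End pointwise.

(** * Hellinger loss and test statistic in real terms *)

Section real_forms.
Context {R : realType} {k : nat} {d : 'I_k -> measure_display}.
Context {X : forall i, measurableType (d i)}.
Variable mu : mtuple R X.
Implicit Types s t u : ftuple R X.
Local Notation cls := (tuple_class mu).

Definition tadd t u : ftuple R X := fun i x => t i x + u i x.

Definition tmid t u : ftuple R X := fun i x => (t i x + u i x) / 2.

Definition ttest t u : ftuple R X :=
  fun i x => testfun (t i x) (u i x) (tmid t u i x).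

(** The real-valued counterpart of [tint]; it is additive without any
    side condition on infinities. *)
Definition tRint (nu : mtuple R X) (f : ftuple R X) : R :=
  \sum_(i < k) (\int[nu i]_x f i x)%R.

Definition tintegrable (nu : mtuple R X) (f : ftuple R X) : Prop :=
  forall i, (nu i).-integrable [set: X i] (EFin \o f i).

Definition hloss t u : R := fine (H2 mu t u).

Lemma tint_tRint nu f : tintegrable nu f ->
  tint nu (fun i x => (f i x)%:E) = (tRint nu f)%:E.
Proof.
move=> fi; rewrite /tint /tRint -sumEFin; apply: eq_bigr => i _.
by rewrite fineK//; exact: integrable_fin_num (fi i).
Qed.

Lemma tintegrableD nu f g : tintegrable nu f -> tintegrable nu g ->
  tintegrable nu (fun i x => f i x + g i x).
Proof.
move=> fi gi i; apply: eq_integrable (integrableD measurableT (fi i) (gi i)) => //.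
Qed.

Lemma tintegrableZ nu f r : tintegrable nu f ->
  tintegrable nu (fun i x => r * f i x).
Proof.
move=> fi i; apply: eq_integrable (integrableZl measurableT r (fi i)) => //.
Qed.

Lemma tRintD nu f g : tintegrable nu f -> tintegrable nu g ->
  tRint nu (fun i x => f i x + g i x) = tRint nu f + tRint nu g.
Proof.
move=> fi gi; rewrite /tRint -big_split; apply: eq_bigr => i _ /=.
exact: RintegralD (fi i) (gi i).
Qed.

Lemma tRintZ nu f r : tintegrable nu f ->
  tRint nu (fun i x => r * f i x) = r * tRint nu f.
Proof.
move=> fi; rewrite /tRint mulr_sumr; apply: eq_bigr => i _.
exact: RintegralZl (fi i).
Qed.

Lemma le_tRint nu f g : tintegrable nu f -> tintegrable nu g ->
  (forall i x, f i x <= g i x) -> tRint nu f <= tRint nu g.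
Proof.
move=> fi gi fg; apply: ler_sum => i _.
by apply: le_Rintegral (fi i) (gi i) _ => // x _; exact: fg.
Qed.

Lemma tuple_class_tadd t u : cls t -> cls u -> cls (tadd t u).
Proof.
move=> tm um i; have [mt t0 ti] := tm i; have [muu u0 ui] := um i; split.
- exact: measurable_funD.
- by move=> x; rewrite addr_ge0.
- exact: tintegrableD (fun i => let: And3 _ _ h := tm i in h)
    (fun i => let: And3 _ _ h := um i in h) i.
Qed.

Lemma tuple_class_integrable t : cls t -> tintegrable mu t.
Proof. by move=> tm i; have [] := tm i. Qed.

Lemma tuple_class_ge0 t : cls t -> forall i x, 0 <= t i x.
Proof. by move=> tm i; have [] := tm i. Qed.

Lemma tuple_class_measurable t : cls t ->
  forall i, measurable_fun [set: X i] (t i).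
Proof. by move=> tm i; have [] := tm i. Qed.

Lemma dominated_tintegrable t (f : ftuple R X) r : cls t ->
  (forall i, measurable_fun [set: X i] (f i)) ->
  (forall i x, `|f i x| <= r * t i x) -> tintegrable mu f.
Proof.
move=> tm mf ft i.
apply: le_integrable (tintegrableZ mu t r (tuple_class_integrable t tm) i) => //.
- exact/measurable_EFinP.
- move=> x _ /=; rewrite lee_fin (le_trans (ft i x))//; exact: ler_norm.
Qed.

Lemma measurable_sqrt_comp d' (T : measurableType d') (f : T -> R) :
  measurable_fun [set: T] f -> measurable_fun [set: T] (fun x => Num.sqrt (f x)).
Proof.
move=> mf; apply: (measurableT_comp _ mf).
by apply: continuous_measurable_fun; exact: sqrt_continuous.
Qed.

Lemma measurable_div_comp d' (T : measurableType d') (f g : T -> R) :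
  measurable_fun [set: T] f -> measurable_fun [set: T] g ->
  (forall x, 0 <= g x) -> measurable_fun [set: T] (fun x => f x / g x).
Proof.
move=> mf mg g0; apply: measurable_funM => //.
rewrite (_ : (fun x => (g x)^-1) = (@powR R ^~ (-1)) \o g); last first.
  by apply: funext => x /=; rewrite powR_inv1.
by apply: measurableT_comp => //; exact: measurable_powR.
Qed.

Lemma measurable_tmid t u : cls t -> cls u ->
  forall i, measurable_fun [set: X i] (tmid t u i).
Proof.
move=> tm um i; apply: measurable_funM => //.
exact: measurable_funD (tuple_class_measurable t tm i) (tuple_class_measurable u um i).
Qed.

Lemma tmid_ge0 t u : cls t -> cls u -> forall i x, 0 <= tmid t u i x.
Proof.
move=> tm um i x; rewrite divr_ge0// addr_ge0//; exact: tuple_class_ge0.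
Qed.

Lemma measurable_ttest t u : cls t -> cls u ->
  forall i, measurable_fun [set: X i] (ttest t u i).
Proof.
move=> tm um i; have r0 := tmid_ge0 t u tm um i.
have mr := measurable_tmid t u tm um i.
have mt := tuple_class_measurable t tm i.
have mu' := tuple_class_measurable u um i.
apply: measurable_funM => //; apply: measurable_funB;
  by apply: measurable_sqrt_comp; apply: measurable_div_comp.
Qed.

Lemma ttest_bounded t u : cls t -> cls u -> forall i x, `|ttest t u i x| <= 1.
Proof.
move=> tm um i x; have t0 := tuple_class_ge0 t tm i x.
have u0 := tuple_class_ge0 u um i x.
have hb := sqrtr_div_mid_le2 (t i x) (u i x) t0 u0.
have ha := sqrtr_div_mid_le2 (u i x) (t i x) u0 t0.
rewrite (addrC (u i x)) in ha; rewrite /ttest /testfun /tmid.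
have := sqrtr_ge0 (u i x / ((t i x + u i x) / 2)).
have := sqrtr_ge0 (t i x / ((t i x + u i x) / 2)).
have h2 : Num.sqrt 2 ^+ 2 = 2 :> R by rewrite sqr_sqrtr.
have h20 : 0 <= Num.sqrt 2 :> R by exact: sqrtr_ge0.
have q2 : Num.sqrt 2 <= 2 :> R by nra.
by move=> a0 b0; rewrite ler_norml; apply/andP; split; lra.
Qed.

End real_forms.

Section hellinger_loss.
Context {R : realType} {k : nat} {d : 'I_k -> measure_display}.
Context {X : forall i, measurableType (d i)}.
Variable mu : mtuple R X.
Implicit Types s t u : ftuple R X.
Local Notation cls := (tuple_class mu).
Local Notation h2 := (hloss mu).

Lemma sqrte_div (x y : R) : 0 <= x -> 0 <= y -> (y = 0 -> x = 0) ->
  sqrte (x%:E / y%:E) = (Num.sqrt (x / y))%:E.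
Proof.
move=> x0 y0 yx; have [yE|yN] := eqVneq y 0.
  by rewrite (yx yE) mul0e sqrte0 mul0r sqrtr0.
by rewrite inver (negbTE yN) -EFinM.
Qed.

Lemma sqrte_ratio (t u : R) : 0 <= t -> 0 <= u -> 0 < t + u ->
  sqrte ((1 + t%:E / u%:E)^-1)%E = (Num.sqrt (u / (t + u)))%:E.
Proof.
move=> t0 u0 tu0.
have [uE|uN] := eqVneq u 0; last first.
  have u1 : 0 < u by rewrite lt_neqAle eq_sym uN.
  rewrite inver (negbTE uN) -EFinM -EFinD inver.
  have h : 0 < 1 + t / u by rewrite ltr_pwDl// divr_ge0.
  rewrite (gt_eqF h)/=; congr (Num.sqrt _)%:E.
  by field; rewrite uN gt_eqF//= ltr_wpDl.
have t1 : 0 < t by rewrite uE addr0 in tu0.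
by rewrite uE inve0 gt0_muley ?lte_fin// addey// invey sqrte0 mul0r sqrtr0.
Qed.

(** Writing everything over the midpoint [(t + u) / 2] turns the statistic
    [psi] into half the difference of [sqrt (u / r)] and [sqrt (t / r)], which
    is what the selection criterion integrates against the observation. *)
Lemma psi_ttest t u : cls t -> cls u ->
  psi t u = fun i x => (ttest t u i x)%:E.
Proof.
move=> tm um; apply: functional_extensionality_dep => i; apply/funext => x.
have t0 := tuple_class_ge0 mu t tm i x; have u0 := tuple_class_ge0 mu u um i x.
rewrite /psi /ttest /testfun /tmid.
have r20 : 0 < Num.sqrt 2 :> R by rewrite sqrtr_gt0.
have e2 : Num.sqrt 2 ^+ 2 = 2 :> R by rewrite sqr_sqrtr.
have sq (y w : R) : 0 <= y -> Num.sqrt (w / (y / 2)) = Num.sqrt 2 * Num.sqrt (w / y).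
  by move=> y0; rewrite invfM invrK mulrA mulrC sqrtrM.
have [tu|tu] := leP (t i x + u i x) 0.
  have tE : t i x = 0 by apply/le_anti/andP; split=> //; lra.
  have uE : u i x = 0 by apply/le_anti/andP; split=> //; lra.
  by rewrite tE uE !(mul0r, sqrtr0, subrr) mul0e adde0 inve1 subee// mule0.
rewrite !sqrte_ratio//; last by rewrite addrC.
rewrite -EFinB -EFinM; congr EFin; rewrite (addrC (u i x)) !sq ?addr_ge0//.
rewrite -mulrBr; move: (_ - _) => D0.
apply: (mulfI (lt0r_neq0 r20)); rewrite !mulrA divff ?lt0r_neq0// mul1r.
by rewrite -expr2 e2; field.
Qed.

Lemma hloss_integrand_tintegrable t u : cls t -> cls u ->
  tintegrable mu (fun i x => (Num.sqrt (t i x) - Num.sqrt (u i x)) ^+ 2).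
Proof.
move=> tm um; apply: (dominated_tintegrable _ (tadd t u) _ 2).
- exact: tuple_class_tadd.
- move=> i; apply: measurable_funX; apply: measurable_funB;
    apply: measurable_sqrt_comp; exact: tuple_class_measurable.
- move=> i x; rewrite ger0_norm ?sqr_ge0// /tadd.
  have := sqr_sqrtr (tuple_class_ge0 _ _ tm i x).
  have := sqr_sqrtr (tuple_class_ge0 _ _ um i x).
  have := sqrtr_ge0 (t i x); have := sqrtr_ge0 (u i x).
  move: (Num.sqrt _) (Num.sqrt _) => a b a0 b0; nra.
Qed.

Lemma H2E t u : cls t -> cls u ->
  H2 mu t u = (2^-1 * tRint mu
    (fun i x => (Num.sqrt (t i x) - Num.sqrt (u i x)) ^+ 2))%:E.
Proof. by move=> tm um; rewrite /H2 tint_tRint//; exact: hloss_integrand_tintegrable. Qed.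

Lemma H2_hloss t u : cls t -> cls u -> H2 mu t u = (h2 t u)%:E.
Proof. by move=> tm um; rewrite /hloss H2E. Qed.

Lemma hlossE t u : cls t -> cls u ->
  h2 t u = 2^-1 * tRint mu
    (fun i x => (Num.sqrt (t i x) - Num.sqrt (u i x)) ^+ 2).
Proof. by move=> tm um; rewrite /hloss H2E. Qed.

Lemma H2_ge0 t u : (0 <= H2 mu t u)%E.
Proof.
rewrite /H2 mule_ge0// sume_ge0// => i _; apply: integral_ge0 => x _.
by rewrite lee_fin sqr_ge0.
Qed.

Lemma hloss_ge0 t u : 0 <= h2 t u.
Proof. by rewrite fine_ge0// H2_ge0. Qed.

Lemma H2C t u : H2 mu t u = H2 mu u t.
Proof.
rewrite /H2; congr (_ * tint _ _)%E; apply: functional_extensionality_dep => i.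
by apply/funext => x; rewrite -sqrrN opprB.
Qed.

Lemma hlossC t u : h2 t u = h2 u t.
Proof. by rewrite /hloss H2C. Qed.

Lemma hlossxx t : h2 t t = 0.
Proof.
rewrite /hloss /H2 /tint big1 ?mule0// => i _.
by apply: integral0_eq => x _; rewrite subrr expr0n.
Qed.

Lemma hloss_triangle t u v : cls t -> cls u -> cls v ->
  h2 t v <= 2 * h2 t u + 2 * h2 u v.
Proof.
move=> tm um vm; rewrite !hlossE//.
rewrite [leRHS](_ : _ = 2^-1 *
  (2 * tRint mu (fun i x => (Num.sqrt (t i x) - Num.sqrt (u i x)) ^+ 2) +
   2 * tRint mu (fun i x => (Num.sqrt (u i x) - Num.sqrt (v i x)) ^+ 2))); last by lra.
rewrite ler_wpM2l ?invr_ge0//.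
have tu := hloss_integrand_tintegrable _ _ tm um.
have uv := hloss_integrand_tintegrable _ _ um vm.
rewrite -!tRintZ// -tRintD//; try exact: tintegrableZ.
apply: le_tRint; [exact: hloss_integrand_tintegrable| |].
  by apply: tintegrableD; exact: tintegrableZ.
move=> i x; move: (Num.sqrt (t i x)) (Num.sqrt (u i x)) (Num.sqrt (v i x)) => a b c.
have : 0 <= (a - b - (b - c)) ^+ 2 by exact: sqr_ge0.
lra.
Qed.

End hellinger_loss.

Section criterion.
Context {R : realType} {k : nat} {d : 'I_k -> measure_display}.
Context {X : forall i, measurableType (d i)}.
Variable mu : mtuple R X.
Implicit Types s t u w r : ftuple R X.
Implicit Types nu : mtuple R X.
Local Notation cls := (tuple_class mu).
Local Notation h2 := (hloss mu).

Definition finite_masses nu : Prop :=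
  forall i, (nu i [set: X i] < +oo)%E.

Lemma bounded_tintegrable nu (f : ftuple R X) (B : R) : finite_masses nu ->
  (forall i, measurable_fun [set: X i] (f i)) ->
  (forall i x, `|f i x| <= B) -> tintegrable nu f.
Proof.
move=> nufin mf fB i; apply: measurable_bounded_integrable => //.
exists B; split; first exact: num_real.
by move=> y By x _ /=; rewrite (le_trans (fB i x))// ltW.
Qed.

Definition Zreal s nu t u : R :=
  tRint nu (ttest t u) - tRint mu (fun i x => ttest t u i x * s i x).

Lemma ttest_s_tintegrable s t u : cls s -> cls t -> cls u ->
  tintegrable mu (fun i x => ttest t u i x * s i x).
Proof.
move=> sm tm um; apply: (dominated_tintegrable _ s _ 1) => //.
  move=> i; apply: measurable_funM; first exact: measurable_ttest.
  exact: tuple_class_measurable.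
move=> i x; rewrite normrM (ger0_norm (tuple_class_ge0 _ _ sm i x)).
by rewrite ler_wpM2r ?(tuple_class_ge0 _ _ sm)//; exact: ttest_bounded.
Qed.

Lemma Zstat_Zreal s nu t u : finite_masses nu -> cls s -> cls t -> cls u ->
  Zstat mu s nu t u = (Zreal s nu t u)%:E.
Proof.
move=> nufin sm tm um; rewrite /Zstat (psi_ttest mu)//.
rewrite tint_tRint; last first.
  apply: (bounded_tintegrable _ _ 1 nufin); first exact: (measurable_ttest mu).
  exact: (ttest_bounded mu).
rewrite [X in (_ - X)%E](_ : _ = (tRint mu (fun i x => ttest t u i x * s i x))%:E)//.
by rewrite -tint_tRint//; exact: ttest_s_tintegrable.
Qed.

Definition critR (pen : ftuple R X -> R) nu r w : R :=
  2^-1 * (tRint mu (fun i x => Num.sqrt (w i x * r i x)) +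
          tRint nu (fun i x => Num.sqrt (w i x / r i x))) -
  2^-1 * tRint mu w - pen w.

Lemma rho_tintegrable t u : cls t -> cls u ->
  tintegrable mu (fun i x => Num.sqrt (t i x * u i x)).
Proof.
move=> tm um; apply: (dominated_tintegrable _ (tadd t u) _ 1).
- exact: tuple_class_tadd.
- move=> i; apply: measurable_sqrt_comp; apply: measurable_funM;
    exact: tuple_class_measurable.
- move=> i x; rewrite ger0_norm ?sqrtr_ge0// /tadd mul1r.
  have t0 := tuple_class_ge0 _ _ tm i x; have u0 := tuple_class_ge0 _ _ um i x.
  rewrite -[leRHS]ger0_norm ?addr_ge0// -sqrtr_sqr ler_wsqrtr//.
  by move: (t i x) (u i x) t0 u0 => a b a0 b0; nra.
Qed.

Lemma tuple_class_tmid t u : cls t -> cls u -> cls (tmid t u).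
Proof.
move=> tm um i; split.
- exact: measurable_tmid.
- by move=> x; apply: (tmid_ge0 mu).
- have := tuple_class_integrable _ _ (tuple_class_tadd _ _ _ tm um).
  move=> /(tintegrableZ mu _ 2^-1)/(_ i); apply: eq_integrable => // x _ /=.
  by rewrite /tadd /tmid mulrC.
Qed.

Lemma tmidC t u : tmid t u = tmid u t.
Proof.
apply: functional_extensionality_dep => i.
by apply/funext => x; rewrite /tmid addrC.
Qed.

Lemma ratio_tintegrable nu t u : finite_masses nu -> cls t -> cls u ->
  tintegrable nu (fun i x => Num.sqrt (u i x / tmid t u i x)).
Proof.
move=> nufin tm um; apply: (bounded_tintegrable _ _ (Num.sqrt 2) nufin).
- move=> i; apply: measurable_sqrt_comp; apply: measurable_div_comp.
  + exact: (tuple_class_measurable mu).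
  + exact: (measurable_tmid mu).
  + exact: (tmid_ge0 mu).
- move=> i x; rewrite ger0_norm ?sqrtr_ge0// sqrtr_div_mid_le2//;
    exact: (tuple_class_ge0 mu).
Qed.

Lemma crit_critR (pen : ftuple R X -> R) nu t u :
  finite_masses nu -> cls t -> cls u ->
  (rhor mu (tmid t u) nu u - (2^-1)%:E * tint mu (fun i x => (u i x)%:E)
   - (pen u)%:E)%E = (critR pen nu (tmid t u) u)%:E.
Proof.
move=> nufin tm um; rewrite /rhor /rho /critR.
have -> : (fun i x => sqrte ((u i x)%:E / (tmid t u i x)%:E)%E) =
    (fun i x => (Num.sqrt (u i x / tmid t u i x))%:E) :> (forall i, X i -> \bar R).
  apply: functional_extensionality_dep => i; apply/funext => x.
  have t0 := tuple_class_ge0 _ _ tm i x; have u0 := tuple_class_ge0 _ _ um i x.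
  rewrite sqrte_div//; first exact: (tmid_ge0 mu).
  by rewrite /tmid => e; apply/le_anti/andP; split=> //; lra.
have rm := tuple_class_tmid _ _ tm um.
rewrite (tint_tRint mu _ (rho_tintegrable _ _ um rm)).
rewrite (tint_tRint nu _ (ratio_tintegrable _ _ _ nufin tm um)).
by rewrite (tint_tRint mu u)//; exact: tuple_class_integrable.
Qed.

Lemma Tstat_critR pen nu t u : finite_masses nu -> cls t -> cls u ->
  Tstat mu pen nu t u =
  (critR pen nu (tmid t u) u - critR pen nu (tmid t u) t)%:E.
Proof.
move=> nufin tm um; rewrite /Tstat -/(tmid t u) crit_critR//.
by rewrite {2 3}tmidC crit_critR// tmidC EFinB.
Qed.

(** Both tests use the same midpoint; finiteness of the masses excludes the
    indeterminate difference of two infinite criteria. *)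
Lemma Tstat_antisym pen nu t u : finite_masses nu -> cls t -> cls u ->
  (0 <= Tstat mu pen nu t u)%E \/ (0 <= Tstat mu pen nu u t)%E.
Proof.
move=> nufin tm um; rewrite !Tstat_critR// (tmidC u) !lee_fin.
by have [] := leP (critR pen nu (tmid t u) t) (critR pen nu (tmid t u) u);
  [left|right]; lra.
Qed.

Lemma tRint_test_drift_le s t u : cls s -> cls t -> cls u ->
  tRint mu (fun i x => ttest t u i x * s i x) +
  2^-1 * (tRint mu (fun i x => Num.sqrt (u i x * tmid t u i x)) -
          tRint mu (fun i x => Num.sqrt (t i x * tmid t u i x)) +
          tRint mu t - tRint mu u) <=
  (1 + (Num.sqrt 2)^-1) * h2 s t - (1 - (Num.sqrt 2)^-1) * h2 s u.
Proof.
move=> sm tm um; have rm := tuple_class_tmid _ _ tm um.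
have i1 := ttest_s_tintegrable _ _ _ sm tm um.
have i2 := rho_tintegrable _ _ um rm; have i3 := rho_tintegrable _ _ tm rm.
have i4 := tuple_class_integrable _ _ tm.
have i5 := tuple_class_integrable _ _ um.
have i6 := hloss_integrand_tintegrable _ _ _ sm tm.
have i7 := hloss_integrand_tintegrable _ _ _ sm um.
(* Both sides are single integrals, which reduces the claim to the pointwise
   inequality. *)
have F1 := tintegrableZ _ _ (- 1) i3; have F2 := tintegrableZ _ _ (- 1) i5.
have F3 := tintegrableD _ _ _ i2 F1; have F4 := tintegrableD _ _ _ F3 i4.
have F5 := tintegrableD _ _ _ F4 F2; have F6 := tintegrableZ _ _ 2^-1 F5.
have F7 := tintegrableD _ _ _ i1 F6.
have G1 := tintegrableZ _ _ ((1 + (Num.sqrt 2)^-1) / 2) i6.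
have G2 := tintegrableZ _ _ (- ((1 - (Num.sqrt 2)^-1) / 2)) i7.
have G3 := tintegrableD _ _ _ G1 G2.
have := le_tRint _ _ _ F7 G3.
rewrite !tRintD// !tRintZ// !tRintD// !tRintZ// !hlossE// => hle.
suff /hle : forall i x,
    ttest t u i x * s i x + 2^-1 * (Num.sqrt (u i x * tmid t u i x) +
      -1 * Num.sqrt (t i x * tmid t u i x) + t i x + -1 * u i x) <=
    (1 + (Num.sqrt 2)^-1) / 2 * (Num.sqrt (s i x) - Num.sqrt (t i x)) ^+ 2 +
    - ((1 - (Num.sqrt 2)^-1) / 2) * (Num.sqrt (s i x) - Num.sqrt (u i x)) ^+ 2.
  lra.
move=> i x; have := test_drift_le _ _ _ _ (tuple_class_ge0 _ _ sm i x)
  (tuple_class_ge0 _ _ tm i x) (tuple_class_ge0 _ _ um i x) (erefl _).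
rewrite /ttest /tmid; lra.
Qed.

(** The test differs from its expectation by exactly Z, and the expectation is
    bounded by the drift inequality. *)
Lemma Tstat_ge0_Zreal pen s nu t u : finite_masses nu ->
  cls s -> cls t -> cls u -> (0 <= Tstat mu pen nu t u)%E ->
  (1 - (Num.sqrt 2)^-1) * h2 s u + pen u <=
  (1 + (Num.sqrt 2)^-1) * h2 s t + pen t + Zreal s nu t u.
Proof.
move=> nufin sm tm um; rewrite Tstat_critR// lee_fin /critR /Zreal.
have -> : tRint nu (ttest t u) = 2^-1 * (
    tRint nu (fun i x => Num.sqrt (u i x / tmid t u i x)) -
    tRint nu (fun i x => Num.sqrt (t i x / tmid t u i x))).
  have i1 := ratio_tintegrable _ _ _ nufin tm um.
  have i2 := ratio_tintegrable _ _ _ nufin um tm; rewrite tmidC in i2.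
  have i3 := tintegrableZ _ _ (-1) i2.
  rewrite -mulN1r -tRintZ// -tRintD// -tRintZ//; last exact: tintegrableD.
  congr (tRint nu _); apply: functional_extensionality_dep => i.
  by apply/funext => x; rewrite /ttest /testfun mulN1r mulrC.
by have := tRint_test_drift_le _ _ _ sm tm um; lra.
Qed.

End criterion.

(** * Oracle inequality for the selection procedure on a favourable observation *)

(** The quasi-triangle inequality [(x + y) ^ 2 <= 2 x ^ 2 + 2 y ^ 2], used
    along the path from the intensity to the selected estimator through the
    competing and the selected net points. *)
Lemma combine_distances {R : realFieldType} (K x y q q' g h v u p w e tau : R) :
  x <= 2 * y + 2 * q -> y <= 2 * u + 2 * g -> q' <= 2 * v + 2 * g ->
  u <= 2 * h + 2 * v -> q <= q' + tau -> v + p <= w -> 0 <= K ->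
  g <= (2 + K) * (u + p + e) + tau ->
  0 <= h -> 0 <= v -> 0 <= p -> 0 <= e -> tau <= w ->
  x <= (70 + 24 * K) * (h + w + e).
Proof.
move=> t1 t2 t3 t4 lhle vle K0 g1 h0 v0 p0 e0 tw.
have hK : (2 + K) * (u + p + e) <= (2 + K) * (2 * h + 3 * w + e).
  by apply: ler_wpM2l; lra.
have Kh := mulr_ge0 K0 h0; have Ke := mulr_ge0 K0 e0; lra.
Qed.

Section selection_oracle.
Context {R : realType} {k : nat} {d : 'I_k -> measure_display}.
Context {X : forall i, measurableType (d i)}.
Variables (mu nu : mtuple R X) (s : ftuple R X) (net : set (ftuple R X)).
Variables (pen : ftuple R X -> R) (z e tau : R).
Local Notation cls := (tuple_class mu).
Local Notation h2 := (hloss mu).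

Definition test_gap : R := 1 - (Num.sqrt 2)^-1 - z.

(** [70 + 24 K] with [K = 4 / test_gap], see [combine_distances]. *)
Definition oracle_factor : R := 70 + 96 / test_gap.

Hypothesis nufin : finite_masses nu.
Hypothesis sm : cls s.
Hypothesis netm : net `<=` cls.
Hypothesis pen_ge0 : forall t, net t -> 0 <= pen t.
Hypothesis gap_gt0 : 0 < test_gap.
Hypothesis e_ge0 : 0 <= e.
Hypothesis tau_ge0 : 0 <= tau.
Hypothesis Zle : forall t u, net t -> net u ->
  Zreal mu s nu t u <= z * (h2 s t + h2 s u) + pen t + pen u + e.

(** The penalty of the preferred point appears on both sides and cancels, and
    the positive gap lets its loss be absorbed on the left. *)
Lemma accepted_loss_le t u : net t -> net u -> (0 <= Tstat mu pen nu t u)%E ->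
  h2 s u <= 2 / test_gap * (h2 s t + pen t + e).
Proof.
move=> nt nu' /(Tstat_ge0_Zreal _ _ _ _ _ _ nufin sm (netm _ nt) (netm _ nu')).
have := e_ge0; have := Zle _ _ nt nu'.
rewrite mulrAC ler_pdivlMr//.
have g := gap_gt0; rewrite /test_gap in g *.
have := hloss_ge0 mu s t; have := hloss_ge0 mu s u; have := pen_ge0 _ nt.
move: (Num.sqrt 2)^-1 (h2 s t) (h2 s u) g => q a b g p0 b0 a0 h1 e0 h2.
have : (1 + q + z) * a <= 2 * a by rewrite ler_wpM2r//; lra.
lra.
Qed.

Lemma Dcrit_le (L : Type) (st : L -> ftuple R X) t :
  (forall l, net (st l)) -> net t ->
  (Dcrit mu pen nu st t <=
   ((2 + 4 / test_gap) * (h2 s t + pen t + e))%:E)%E.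
Proof.
move=> nst nt; have g := gap_gt0; have tm := netm _ nt.
have := hloss_ge0 mu s t; have := pen_ge0 _ nt => p0 h0.
have b0 : 0 <= h2 s t + pen t + e by rewrite !addr_ge0.
rewrite /Dcrit ge_max; apply/andP; split.
  by rewrite lee_fin mulr_ge0// addr_ge0// divr_ge0// ltW.
apply: ge_ereal_sup => _ [u [[l _ <-] _ T0] <-].
have um := netm _ (nst l); rewrite H2_hloss// lee_fin.
have := accepted_loss_le _ _ nt (nst l) T0.
have := hloss_triangle mu t s (st l) tm sm um; rewrite (hlossC mu t s).
have -> : 4 / test_gap = 2 * (2 / test_gap) by rewrite mulrA -natrM.
have := e_ge0; move: (2 / test_gap) => K e0 h1 h2; lra.
Qed.

(** Any two estimates are comparable by the test, so whichever of them is
    rejected in favour of the other, their distance is controlled by the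
    selection criterion at the competitor. *)
Lemma direct_selected_dist (L : Type) (st : L -> ftuple R X) lt l :
  (forall l, net (st l)) -> direct_selected mu pen tau nu st lt ->
  h2 (st l) (st lt) <=
  (2 + 4 / test_gap) * (h2 s (st l) + pen (st l) + e) + tau.
Proof.
move=> nst sel; have m l' := netm _ (nst l').
have Dl := Dcrit_le _ _ _ nst (nst l).
rewrite -lee_fin -H2_hloss// EFinD.
have [->|neq] := pselect (st l = st lt).
  rewrite (_ : H2 mu _ _ = 0%E); last by rewrite H2_hloss// hlossxx.
  apply: adde_ge0; last by rewrite lee_fin.
  apply: le_trans (Dcrit_le _ _ _ nst (nst lt)).
  by rewrite /Dcrit le_max lexx.
have H2D t u : (exists l', st l' = u) -> u <> t -> (0 <= Tstat mu pen nu t u)%E ->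
    (H2 mu t u <= Dcrit mu pen nu st t)%E.
  move=> [l' <-] ne T0; rewrite /Dcrit le_max; apply/orP; right.
  by apply: ereal_sup_ubound; exists (st l') => //; split => //; exists l'.
have [T0|T0] := Tstat_antisym mu pen nu (st l) (st lt) nufin (m l) (m lt).
  apply: (le_trans (H2D _ _ _ _ T0)); [by exists lt|exact/nesym|].
  by rewrite (le_trans Dl)// leeDl ?lee_fin.
rewrite H2C (le_trans (H2D _ _ _ neq T0))//; first by exists l.
by rewrite (le_trans (sel l))// leeD2r.
Qed.

Lemma indirect_selected_oracle (L : Type) (sh : L -> ftuple R X) lh l t :
  (forall l, cls (sh l)) -> net t ->
  indirect_selected mu pen tau nu net sh lh ->
  h2 s (sh lh) <=
  oracle_factor * (h2 s (sh l) + (h2 (sh l) t + pen t + tau) + e).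
Proof.
move=> shm nt [st [lt [stP dir lhP]]].
have nst l' : net (st l') by have [] := stP l'.
have m l' := netm _ (nst l').
have vle : h2 (sh l) (st l) + pen (st l) <= h2 (sh l) t + pen t + tau.
  have tm := netm _ nt.
  rewrite -lee_fin !EFinD -!H2_hloss//; have [_ /le_trans] := stP l; apply.
  by rewrite leeD2r//; apply: ereal_inf_lbound; exists t.
have lhle : h2 (sh lh) (st lt) <= h2 (sh l) (st lt) + tau.
  rewrite -lee_fin EFinD -!H2_hloss//; apply: le_trans lhP _.
  by rewrite leeD2r//; apply: ereal_inf_lbound; exists l.
have g := direct_selected_dist _ _ _ l nst dir.
have t1 := hloss_triangle mu s (st lt) (sh lh) sm (m lt) (shm lh).
have t2 := hloss_triangle mu s (st l) (st lt) sm (m l) (m lt).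
have t3 := hloss_triangle mu (sh l) (st l) (st lt) (shm l) (m l) (m lt).
have t4 := hloss_triangle mu s (sh l) (st l) sm (shm l) (m l).
rewrite (hlossC mu (st lt)) in t1.
have -> : oracle_factor = 70 + 24 * (4 / test_gap).
  by rewrite /oracle_factor mulrA -natrM.
apply: (combine_distances _ _ _ _ _ _ _ _ _ _ _ _ _ t1 t2 t3 t4 lhle vle _ g) => //.
- by rewrite divr_ge0// ltW.
- exact: hloss_ge0.
- exact: hloss_ge0.
- exact: pen_ge0.
- by rewrite lerDr addr_ge0 ?hloss_ge0 ?pen_ge0.
Qed.

End selection_oracle.

(** * Measurability of losses and of the test statistic *)

Section measurability.
Context {R : realType} {k : nat} {d : 'I_k -> measure_display}.
Context {X : forall i, measurableType (d i)}.
Context {dO : measure_display} {Omega : measurableType dO}.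
Variables (mu : mtuple R X) (N : forall i, R.-ker Omega ~> X i).
Implicit Types s t u : ftuple R X.
Local Notation cls := (tuple_class mu).

Lemma measurable_obs_preimage (E : set (mtuple R X)) :
  mtuple_sigma E -> measurable (obs N @^-1` E).
Proof.
apply: (smallest_sub (X := [set E | measurable (obs N @^-1` E)])).
  split => /=; first by rewrite preimage_set0.
  - by move=> A mA; rewrite setTD preimage_setC; exact: measurableC.
  - by move=> F mF; rewrite preimage_bigcup; exact: bigcupT_measurable.
move=> _ [i [A [B [mA mB ->]]]] /=.
rewrite [X in measurable X](_ : _ = (fun w => N i w A) @^-1` B); last by [].
by rewrite -[X in measurable X]setTI; exact: (measurable_kernel (N i) A mA).
Qed.

Lemma measurable_le_sublevels (f : Omega -> R) :
  (forall y : R, measurable [set w | f w <= y]) -> measurable_fun [set: Omega] f.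
Proof.
move=> mf; apply: (measurability (@RGenOInfty.G R)).
  exact: RGenOInfty.measurableE.
move=> /= _ [_ [r ->] <-]; rewrite setTI.
rewrite [X in measurable X](_ : _ = ~` [set w | f w <= r]).
  exact: measurableC.
by apply/seteqP; split => w /=; rewrite in_itv /= andbT ltNge => /negP.
Qed.

Lemma hell_le s t (y : R) : cls s -> cls t -> 0 <= y ->
  (hell mu s t <= y%:E)%E = (hloss mu s t <= y ^+ 2).
Proof.
move=> sm tm y0; rewrite /hell H2_hloss//= lee_fin.
rewrite -[in LHS](ger0_norm y0) -sqrtr_sqr ler_sqrt ?sqr_ge0//.
Qed.

Lemma measurable_estimator_loss (L0 : set (ftuple R X)) s
    (sh : mtuple R X -> ftuple R X) : L0 `<=` cls -> L0 s ->
  is_estimator mu L0 sh -> (forall nu, L0 (sh nu)) ->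
  measurable_fun [set: Omega] (fun w => hloss mu s (sh (obs N w))).
Proof.
move=> L0m L0s est shL0; apply: measurable_le_sublevels => y.
have [y0|y0] := leP 0 y; last first.
  rewrite [X in measurable X](_ : _ = set0)//; apply/seteqP; split => w //=.
  by rewrite leNgt (lt_le_trans y0)// hloss_ge0.
rewrite [X in measurable X](_ : _ = obs N @^-1`
    (sh @^-1` (hball mu L0 s (Num.sqrt y)))).
  apply: measurable_obs_preimage; apply: est; apply: sub_sigma_algebra.
  by exists s, (Num.sqrt y).
apply/seteqP; split => w /=; rewrite /hball/= hell_le ?sqrtr_ge0 ?sqr_sqrtr//;
  by [case|exact: L0m|].
Qed.

Lemma measurable_tint_obs (f : ftuple R X) :
  (forall i, measurable_fun [set: X i] (f i)) ->
  measurable_fun [set: Omega] (fun w => tint (obs N w) (fun i x => (f i x)%:E)).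
Proof.
move=> mf; apply: emeasurable_sum => i; rewrite /obs.
under eq_fun do rewrite integralE.
have mk U : measurable U -> measurable_fun [set: Omega] (N i ^~ U).
  exact: measurable_kernel.
apply: emeasurable_funB; apply: measurable_fun_integral_kernel => //.
  by apply: measurable_funepos; exact/measurable_EFinP.
by apply: measurable_funeneg; exact/measurable_EFinP.
Qed.

Lemma measurable_Zstat s t u : cls t -> cls u ->
  measurable_fun [set: Omega] (fun w => Zstat mu s (obs N w) t u).
Proof.
move=> tm um; apply: emeasurable_funB; last exact: measurable_cst.
rewrite (psi_ttest mu)//; apply: measurable_tint_obs => i.
exact: (measurable_ttest mu).
Qed.

Definition infinite_mass : set Omega :=
  \bigcup_(i in [set: 'I_k]) [set w | N i w [set: X i] = +oo%E].

Lemma infinite_massP w : ~ infinite_mass w -> finite_masses (obs N w).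
Proof.
move=> nw i; rewrite ltey; apply/eqP => e; apply: nw; exists i => //.
Qed.

Lemma measurable_infinite_mass : measurable infinite_mass.
Proof.
apply: fin_bigcup_measurable => // i _.
rewrite -[X in measurable X]setTI.
exact: (measurable_kernel (N i) _ measurableT) (emeasurable_set1 +oo%E).
Qed.

Lemma infinite_mass_null (P : probability Omega R) s :
  has_intensity P N mu s -> P infinite_mass = 0%E.
Proof.
move=> int; apply/eqP; rewrite -measure_le0.
pose A i := [set w | N i w [set: X i] = +oo%E].
have mA i : measurable (A i).
  rewrite -[X in measurable X]setTI.
  exact: (measurable_kernel (N i) _ measurableT) (emeasurable_set1 +oo%E).
have := content_sub_fsum P (@finite_finset _ [set: 'I_k]) (fun i _ => mA i)
  measurable_infinite_mass (@subset_refl _ _).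
move=> /le_trans; apply.
rewrite fsbig1// => i _; apply: measure_negligible => //.
have [intE intfin] := int i _ measurableT.
have fi : P.-integrable [set: Omega] (fun w => N i w [set: X i]).
  apply/integrableP; split; first exact: (measurable_kernel (N i) _ measurableT).
  by under eq_integral do rewrite gee0_abs//.
have := integrable_ae measurableT fi; apply: negligibleS => w /= + fin.
by move=> e; have := fin Logic.I; rewrite e.
Qed.

End measurability.

(** * Union bounds *)

Section union_bounds.
Context {R : realType} {dO : measure_display} {Omega : measurableType dO}.
Variable P : probability Omega R.

(** Stated for an arbitrary type, as the nets are sets of functions without
    decidable equality; [A] is enumerated by inverting an injection into the
    first [n] integers. *)
Lemma card_le_union_bound (T : Type) (A : set T) n (E : T -> set Omega) (p : R) :
  (A #<= `I_n)%card -> (forall t, A t -> measurable (E t)) ->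
  (forall t, A t -> (P (E t) <= p%:E)%E) -> 0 <= p ->
  measurable (\bigcup_(t in A) E t) /\
  (P (\bigcup_(t in A) E t) <= (n%:R * p)%:E)%E.
Proof.
move=> An mE pE p0.
have [->|/set0P[t0 At0]] := eqVneq A set0.
  by rewrite bigcup_set0 measure0 lee_fin mulr_ge0.
have [f fA Af] : exists2 f : nat -> T, (forall i, A (f i)) &
    A `<=` f @` `I_n.
  have /pcard_leP[g] := An.
  pose f i := if pselect (exists2 t, A t & g t = i) is left h
    then projT1 (cid2 h) else t0.
  exists f => [i|t At]; first by rewrite /f; case: pselect => // h; case: cid2.
  exists (g t); first exact: funS.
  rewrite /f; case: pselect => [h|]; last by case; exists t.
  by case: cid2 => u Au gu; apply: (@inj _ _ _ g); rewrite ?inE.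
have UE : \bigcup_(t in A) E t = \bigcup_(i in `I_n) E (f i).
  apply/seteqP; split => w.
    by move=> [t /Af[i ni <-] Ew]; exists i.
  by move=> [i _ Ew]; exists (f i).
have mU : measurable (\bigcup_(i in `I_n) E (f i)).
  by apply: fin_bigcup_measurable => // i _; exact: mE.
rewrite UE; split => //.
have := @content_subadditive _ _ _ P _ (fun i => E (f i)) n
  (fun i (_ : `I_n i) => mE _ (fA i)) mU.
have -> : \bigcup_(i in `I_n) E (f i) = \big[setU/set0]_(i < n) E (f i).
  by rewrite bigcup_mkord.
move=> /(_ (@subset_refl _ _))/le_trans; apply.
rewrite (@le_trans _ _ (\sum_(i < n) p%:E)%E)//.
  by apply: lee_sum => i _; exact: pE.
by rewrite sumEFin sumr_const card_ord mulr_natl.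
Qed.

(** Stated with a summable family of weights and a common factor so that it
    can be iterated over several indices. *)
Lemma countable_union_bound (I : countType) (E : I -> set Omega)
    (w : I -> R) (K W : R) :
  0 <= K -> (forall i, 0 <= w i) -> (\esum_(i in [set: I]) (w i)%:E <= W%:E)%E ->
  (forall i, measurable (E i)) -> (forall i, (P (E i) <= (K * w i)%:E)%E) ->
  measurable (\bigcup_i E i) /\ (P (\bigcup_i E i) <= (K * W)%:E)%E.
Proof.
move=> K0 w0 wW mE pE.
pose F n := if pickle_inv n is Some i then E i else set0.
pose q n := if pickle_inv n is Some i then w i else 0.
have q0 n : (0 <= (q n)%:E)%E by rewrite lee_fin /q; case: pickle_inv.
have UE : \bigcup_i E i = \bigcup_n F n.
  apply/seteqP; split => x.
    by move=> [i _ Ex]; exists (pickle i) => //; rewrite /F pickleK_inv.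
  by move=> [n _]; rewrite /F; case: pickle_inv => // i Ex; exists i.
have mF n : measurable (F n) by rewrite /F; case: pickle_inv.
have mU : measurable (\bigcup_n F n) by exact: bigcupT_measurable.
rewrite UE; split => //.
have := measure_sigma_subadditive P mF mU (@subset_refl _ _).
move=> /le_trans; apply.
apply: (@le_trans _ _ (\sum_(n <oo) (K%:E * (q n)%:E))%E).
  apply: lee_nneseries => n _ //; rewrite /F /q.
  by case: pickle_inv => [i|]; rewrite ?pE// measure0 mule0.
rewrite nneseriesZl// EFinM; apply: lee_wpmul2l; first by rewrite lee_fin.
apply: le_trans wW; rewrite nneseries_esumT//.
rewrite (_ : \esum_(i in [set: I]) _ = \esum_(n in range (@pickle I)) (q n)%:E)%E.
  rewrite [leRHS]esum_mkcond; apply: le_esum => n _.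
  case: ifPn => //; rewrite notin_setE => nr; rewrite /q lee_fin.
  have := @pickle_invK I n; rewrite /ocancel/oapp; case: pickle_inv => //= i e.
  by exfalso; apply: nr; exists i.
rewrite (reindex_esum [set: I] _ (@pickle I)); last by split.
by apply: eq_esum => i _; rewrite /q pickleK_inv.
Qed.

Lemma esum_expRN_le2 : (\esum_(j in [set: nat]) (expR (- j%:R))%:E <= 2%:E :> \bar R)%E.
Proof.
have e0 j : (0 <= (expR (- j%:R))%:E :> \bar R)%E by rewrite lee_fin expR_ge0.
rewrite -nneseries_esumT//; apply: lime_le; first exact: is_cvg_nneseries.
apply: nearW => n; rewrite sumEFin lee_fin big_mkord.
suff : \sum_(i < n) expR (- i%:R) <= 2 - 2 * expR (- n%:R) :> R.
  by have := expR_gt0 (- n%:R : R); lra.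
elim: n => [|n IH]; first by rewrite big_ord0 oppr0 expR0; lra.
rewrite big_ord_recr /= -[n.+1%:R]natr1 opprD expRD.
have := expR_gt0 (- n%:R : R); have : expR (- 1) <= 2^-1 :> R.
  by rewrite expRN lef_pV2 ?posrE ?expR_gt0//; have := expR_ge1Dx (1 : R); lra.
move: (expR (-1)) (expR _) IH => q v IH hq v0; nra.
Qed.

End union_bounds.

(** * Uniform deviations of the test statistic over the nets *)

Section shells.
Context {R : realType} {k : nat} {d : 'I_k -> measure_display}.
Context {X : forall i, measurableType (d i)}.
Context {dO : measure_display} {Omega : measurableType dO}.
Variables (P : probability Omega R) (mu : mtuple R X).
Variables (N : forall i, R.-ker Omega ~> X i) (s : ftuple R X).
Variables (L0 : set (ftuple R X)) (z M b a c : R).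
Local Notation tau := (tau_of z a c).
Local Notation h2 := (hloss mu).

Hypothesis L0m : L0 `<=` tuple_class mu.
Hypothesis L0s : L0 s.
Hypothesis z_gt0 : 0 < z.
Hypothesis M_gt0 : 0 < M.
Hypothesis b_ge0 : 0 <= b.
Hypothesis a_gt0 : 0 < a.
Hypothesis c_ge0 : 0 <= c.
Hypothesis tail : forall y xi : R, 0 < y -> 0 < xi ->
  (ereal_sup [set P [set w | (xi%:E < Zstat mu s (obs N w) t t')%E]
             | t in hball mu L0 s y & t' in hball mu L0 s y]
   <= (b * expR (- (a * xi ^+ 2 / (y ^+ 2 + c * xi))))%:E)%E.

Lemma tau_gt0 : 0 < tau.
Proof.
rewrite /tau_of divr_gt0 ?mulr_gt0 ?exprn_gt0//.
by rewrite ltr_wpDr// mulr_ge0// ltW.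
Qed.

(** The part of the penalty contributed by one model, in units of [z tau]. *)
Definition weight (D Delta : R) : R := 4 * eta_of D ^+ 2 + Delta.

Lemma eta_sq (D : R) : eta_of D ^+ 2 = 2 * Num.max D 8^-1.
Proof.
rewrite /eta_of sqr_sqrtr// mulr_ge0// le_max; apply/orP; right.
by rewrite invr_ge0.
Qed.

Lemma weight_ge (D Delta : R) : Delta + 1 <= weight D Delta.
Proof.
rewrite /weight eta_sq; have : 8^-1 <= Num.max D 8^-1 by rewrite le_max lexx orbT.
lra.
Qed.

(** The value of [tau] makes the exponent linear in [v]: with
    [y ^ 2 <= 2 v] and threshold [z v], the exponent
    [a (z v) ^ 2 / (y ^ 2 + c z v)] is at least
    [a z ^ 2 v / (2 + c z) = 4 v / tau]. *)
Lemma tail_shell t u (v y : R) : 0 < v -> y ^+ 2 <= 2 * v -> 0 < y ->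
  hball mu L0 s y t -> hball mu L0 s y u ->
  (P [set w | ((z * v)%:E < Zstat mu s (obs N w) t u)%E] <=
   (b * expR (- (4 * v / tau)))%:E)%E.
Proof.
move=> v0 yv y0 ty uy; have xi0 : 0 < z * v by rewrite mulr_gt0.
apply: le_trans (le_trans _ (tail _ _ y0 xi0)) _.
  by apply: ereal_sup_ubound; exists t => //; exists u.
rewrite lee_fin ler_wpM2l// ler_expR lerN2.
have cz0 : 0 <= c * z by rewrite mulr_ge0// ltW.
have den : 0 < y ^+ 2 + c * (z * v).
  by rewrite ltr_pwDl ?exprn_gt0// mulr_ge0// ltW.
rewrite ler_pdivlMr//.
have -> : 4 * v / tau = a * z ^+ 2 * v / (2 + c * z).
  rewrite /tau_of; field.
  by rewrite !gt_eqF//; lra.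
rewrite mulrAC ler_pdivrMr; last by lra.
have av0 : 0 <= a * z ^+ 2 * v by rewrite !mulr_ge0 ?exprn_ge0 ?ltW.
have -> : a * (z * v) ^+ 2 * (2 + c * z) =
  a * z ^+ 2 * v * (2 * v + c * (z * v)) by ring.
by rewrite ler_wpM2l// lerD2r.
Qed.

(** The choice [eta ^ 2 = 2 max D (1 / 8)] gives [D / eta ^ 2 <= 1 / 2], so the
    dimension disappears from the entropy of a ball. *)
Lemma net_ball_card (net S : set (ftuple R X)) (D y : R) : 0 <= D ->
  is_net mu L0 M (eta_of D * Num.sqrt tau) D net S -> 0 <= y ->
  4 * eta_of D ^+ 2 * tau <= y ^+ 2 ->
  exists2 n : nat, ([set t | net t /\ (hell mu s t <= y%:E)%E] #<= `I_n)%card &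
    n%:R <= M * expR (y ^+ 2 / (2 * tau)).
Proof.
move=> D0 [_ _ card] y0 hy; have t0 := tau_gt0.
have eta0 : 0 < eta_of D ^+ 2 by rewrite eta_sq mulr_gt0// lt_max orbC invr_gt0 ltr0n.
have [n [An nM]] : exists n : nat,
    ([set t | net t /\ (hell mu s t <= y%:E)%E] #<= `I_n)%card /\
    n%:R <= M * expR (D * (y / (eta_of D * Num.sqrt tau)) ^+ 2).
  apply: card => //.
  rewrite -ler_sqr ?nnegrE// ?mulr_ge0 ?sqrtr_ge0// !exprMn (sqr_sqrtr (ltW t0)).
  by apply: le_trans hy; rewrite mulrA expr2; lra.
exists n => //; apply: le_trans nM _.
rewrite ler_wpM2l ?(ltW M_gt0)// ler_expR expr_div_n exprMn (sqr_sqrtr (ltW t0)).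
rewrite mulrA (ler_pdivrMr _ _ (mulr_gt0 eta0 t0)).
have -> : y ^+ 2 / (2 * tau) * (eta_of D ^+ 2 * tau) = y ^+ 2 * eta_of D ^+ 2 / 2.
  by field; rewrite gt_eqF.
rewrite mulrC -mulrA ler_wpM2l ?sqr_ge0// eta_sq mulrAC divff// mul1r.
by rewrite le_max lexx.
Qed.

(** The shells in [H2 s t + H2 s u] have constant width [u0], so that every pair
    belongs to one of them, and [j + 2 <= 2 (j + 1)] keeps the squared radius of
    the balls within a factor 2 of the threshold over [z]. *)
Definition shell_event (net net' : set (ftuple R X)) (u0 : R) (j : nat) :=
  let y := Num.sqrt (j.+2%:R * u0) in
  \bigcup_(t in [set t | net t /\ (hell mu s t <= y%:E)%E])
  \bigcup_(u in [set u | net' u /\ (hell mu s u <= y%:E)%E])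
    [set w | ((z * (j.+1%:R * u0))%:E < Zstat mu s (obs N w) t u)%E].

(** With [v = (j + 1) u0] there are at most [M ^ 2 exp (2 v / tau)] pairs, each
    contributing [b exp (- 4 v / tau)]. The remaining exponent [2 v / tau] is at
    least [Delta + Delta' + n + j] because a weight is at least [Delta + 1]. *)
Lemma shell_event_le (net net' S S' : set (ftuple R X)) (D D' Delta Delta' : R)
    (n j : nat) :
  0 <= D -> 0 <= D' -> 1 <= Delta -> 1 <= Delta' -> S `<=` L0 -> S' `<=` L0 ->
  is_net mu L0 M (eta_of D * Num.sqrt tau) D net S ->
  is_net mu L0 M (eta_of D' * Num.sqrt tau) D' net' S' ->
  let u0 := tau * (weight D Delta + weight D' Delta' + n%:R) in
  measurable (shell_event net net' u0 j) /\
  (P (shell_event net net' u0 j) <=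
   (b * M ^+ 2 * expR (- n%:R) * expR (- Delta) * expR (- Delta')
    * expR (- j%:R))%:E)%E.
Proof.
move=> D0 D0' Dl1 Dl1' SL0 SL0' hnet hnet' u0.
have t0 := tau_gt0; have w1 := weight_ge D Delta; have w1' := weight_ge D' Delta'.
have n0 : 0 <= n%:R :> R by []. have j0 : 0 <= j%:R :> R by [].
pose U := weight D Delta + weight D' Delta' + n%:R.
have u00 : 0 < u0 by rewrite mulr_gt0//; lra.
set y := Num.sqrt (j.+2%:R * u0); set v := j.+1%:R * u0.
have v0 : 0 < v by rewrite mulr_gt0.
have y2 : y ^+ 2 = j.+2%:R * u0 by rewrite sqr_sqrtr// mulr_ge0// (ltW u00).
have y0 : 0 < y by rewrite sqrtr_gt0 mulr_gt0.
have yv : y ^+ 2 <= 2 * v.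
  by rewrite y2 /v mulrA ler_wpM2r ?(ltW u00)// -(natr1 j.+1) -(natr1 j); lra.
(* As [u0 >= 4 eta ^ 2 tau] for both nets, this puts the radius in the range of
   their cardinality bounds. *)
have uy : u0 <= y ^+ 2 by rewrite y2 ler_peMl ?(ltW u00)// ler1n.
have big D1 Delta1 : 1 <= Delta1 -> tau * weight D1 Delta1 <= u0 ->
    4 * eta_of D1 ^+ 2 * tau <= y ^+ 2.
  move=> h1 h2; apply: le_trans uy; apply: le_trans h2; rewrite mulrC.
  by rewrite ler_wpM2l ?ltW// /weight; lra.
have [|m mc mM] := net_ball_card _ _ _ _ D0 hnet (ltW y0).
  by apply: (big _ _ Dl1); rewrite ler_wpM2l ?(ltW t0)//; lra.
have [|m' mc' mM'] := net_ball_card _ _ _ _ D0' hnet' (ltW y0).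
  by apply: (big _ _ Dl1'); rewrite ler_wpM2l ?(ltW t0)//; lra.
have [netS _ _] := hnet; have [netS' _ _] := hnet'.
set p := b * expR (- (4 * v / tau)).
have p0 : 0 <= p by rewrite mulr_ge0// expR_ge0.
have inner t : [set t | net t /\ (hell mu s t <= y%:E)%E] t ->
    measurable (\bigcup_(u in [set u | net' u /\ (hell mu s u <= y%:E)%E])
      [set w | ((z * v)%:E < Zstat mu s (obs N w) t u)%E]) /\
    (P (\bigcup_(u in [set u | net' u /\ (hell mu s u <= y%:E)%E])
      [set w | ((z * v)%:E < Zstat mu s (obs N w) t u)%E]) <= (m'%:R * p)%:E)%E.
  move=> [nt ty]; apply: card_le_union_bound => // u [nu uy'].
    rewrite -[X in measurable X]setTI; apply: emeasurable_fun_o_infty => //.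
    by apply: measurable_Zstat; apply: L0m; [exact/SL0/netS|exact/SL0'/netS'].
  apply: (tail_shell _ _ _ _ v0 yv y0); split => //.
    exact/SL0/netS.
  exact/SL0'/netS'.
have [|mA PA] := card_le_union_bound P _ _ _ _ (m'%:R * p) mc
  (fun t ht => (inner t ht).1) (fun t ht => (inner t ht).2).
  by rewrite mulr_ge0.
split=> //; apply: le_trans PA _; rewrite lee_fin.
apply: (@le_trans _ _ ((M * expR (y ^+ 2 / (2 * tau))) *
  ((M * expR (y ^+ 2 / (2 * tau))) * p))).
  by rewrite ler_pM// ?mulr_ge0// ler_wpM2r.
rewrite /p.
have -> : M * expR (y ^+ 2 / (2 * tau)) * (M * expR (y ^+ 2 / (2 * tau)) *
    (b * expR (- (4 * v / tau)))) =
  b * M ^+ 2 * (expR (y ^+ 2 / (2 * tau)) * expR (y ^+ 2 / (2 * tau)) *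
    expR (- (4 * v / tau))) by ring.
have -> : b * M ^+ 2 * expR (- n%:R) * expR (- Delta) * expR (- Delta') *
    expR (- j%:R) = b * M ^+ 2 * (expR (- n%:R) * expR (- Delta) *
    expR (- Delta') * expR (- j%:R)) by ring.
rewrite ler_wpM2l ?mulr_ge0 ?exprn_ge0 ?(ltW M_gt0)// -!expRD ler_expR.
have -> : 4 * v / tau = 4 * (j.+1%:R * U).
  by rewrite /v /u0 -/U; field; rewrite gt_eqF.
have yU : y ^+ 2 / (2 * tau) = j.+2%:R * U / 2.
  by rewrite y2 /u0 -/U; field; rewrite gt_eqF.
rewrite yU -(natr1 j.+1) -(natr1 j).
have : 0 <= j%:R * (U - 1) by rewrite mulr_ge0// /U; lra.
rewrite /U; lra.
Qed.

End shells.

(** * Exceptional events *)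

Section exceptional.
Context {R : realType} {k : nat} {d : 'I_k -> measure_display}.
Context {X : forall i, measurableType (d i)}.
Context {dO : measure_display} {Omega : measurableType dO}.
Variables (P : probability Omega R) (mu : mtuple R X).
Variables (N : forall i, R.-ker Omega ~> X i) (s : ftuple R X).
Variables (L0 : set (ftuple R X)) (z M b a c : R).
Local Notation tau := (tau_of z a c).
Local Notation h2 := (hloss mu).

Hypothesis L0m : L0 `<=` tuple_class mu.
Hypothesis L0s : L0 s.
Hypothesis int : has_intensity P N mu s.
Hypothesis z_gt0 : 0 < z.
Hypothesis M_gt0 : 0 < M.
Hypothesis b_ge0 : 0 <= b.
Hypothesis a_gt0 : 0 < a.
Hypothesis c_ge0 : 0 <= c.
Hypothesis tail : forall y xi : R, 0 < y -> 0 < xi ->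
  (ereal_sup [set P [set w | (xi%:E < Zstat mu s (obs N w) t t')%E]
             | t in hball mu L0 s y & t' in hball mu L0 s y]
   <= (b * expR (- (a * xi ^+ 2 / (y ^+ 2 + c * xi))))%:E)%E.

Variables (I : countType) (S net : I -> set (ftuple R X)) (Delta D : I -> R).
Variable Sigma : R.
Hypothesis SL0 : forall m, S m `<=` L0.
Hypothesis Delta_ge1 : forall m, 1 <= Delta m.
Hypothesis Delta_sum :
  (\esum_(m in [set: I]) (expR (- Delta m))%:E = Sigma%:E)%E.
Hypothesis D_ge0 : forall m, 0 <= D m.
Hypothesis net_is_net : forall m,
  is_net mu L0 M (eta_of (D m) * Num.sqrt tau) (D m) (net m) (S m).

Local Notation pen := (net_pen z tau net D Delta).

Definition pair_scale (m m' : I) (n : nat) : R :=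
  tau * (weight (D m) (Delta m) + weight (D m') (Delta m') + n%:R).

Definition exceptional (n : nat) : set Omega :=
  infinite_mass N `|` \bigcup_m \bigcup_m' \bigcup_j
    shell_event mu N s z (net m) (net m') (pair_scale m m' n) j.

Lemma Sigma_ge0 : 0 <= Sigma.
Proof.
by rewrite -lee_fin -Delta_sum esum_ge0// => m _; rewrite lee_fin expR_ge0.
Qed.

(** The factor [2] bounds the geometric series over [j], and each sum over the
    models contributes one factor [Sigma]. *)
Lemma exceptional_le n :
  measurable (exceptional n) /\
  (P (exceptional n) <= (2 * (b * M ^+ 2) * Sigma ^+ 2 * expR (- n%:R))%:E)%E.
Proof.
pose K := b * M ^+ 2 * expR (- n%:R).
have K0 : 0 <= K by rewrite !mulr_ge0 ?expR_ge0 ?exprn_ge0// ltW.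
have e0 x : 0 <= expR x :> R by exact: expR_ge0.
have Sle : (\esum_(m in [set: I]) (expR (- Delta m))%:E <= Sigma%:E)%E.
  by rewrite Delta_sum.
have step1 m m' : measurable (\bigcup_j
      shell_event mu N s z (net m) (net m') (pair_scale m m' n) j) /\
    (P (\bigcup_j shell_event mu N s z (net m) (net m') (pair_scale m m' n) j)
     <= (K * expR (- Delta m) * 2 * expR (- Delta m'))%:E)%E.
  have sh := shell_event_le P mu N s L0 z M b a c L0m L0s z_gt0 M_gt0 b_ge0
    a_gt0 c_ge0 tail _ _ _ _ _ _ _ _ n _ (D_ge0 m) (D_ge0 m') (Delta_ge1 m)
    (Delta_ge1 m') (SL0 m) (SL0 m') (net_is_net m) (net_is_net m').
  have -> : K * expR (- Delta m) * 2 * expR (- Delta m') =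
    K * expR (- Delta m) * expR (- Delta m') * 2 by ring.
  have K1 := mulr_ge0 (mulr_ge0 K0 (e0 (- Delta m))) (e0 (- Delta m')).
  exact: (countable_union_bound P _ _ _ _ _ K1 (fun j => e0 _) esum_expRN_le2
    (fun j => (sh j).1) (fun j => (sh j).2)).
have step2 m : measurable (\bigcup_m' \bigcup_j
      shell_event mu N s z (net m) (net m') (pair_scale m m' n) j) /\
    (P (\bigcup_m' \bigcup_j shell_event mu N s z (net m) (net m')
      (pair_scale m m' n) j) <= (K * 2 * Sigma * expR (- Delta m))%:E)%E.
  have -> : K * 2 * Sigma * expR (- Delta m) =
    K * expR (- Delta m) * 2 * Sigma by ring.
  have K1 := mulr_ge0 (mulr_ge0 K0 (e0 (- Delta m))) (ler0n R 2).
  exact: (countable_union_bound P _ _ _ _ _ K1 (fun j => e0 _) Sle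
    (fun m' => (step1 m m').1) (fun m' => (step1 m m').2)).
have [mU PU] : measurable (\bigcup_m \bigcup_m' \bigcup_j
      shell_event mu N s z (net m) (net m') (pair_scale m m' n) j) /\
    (P (\bigcup_m \bigcup_m' \bigcup_j shell_event mu N s z (net m) (net m')
      (pair_scale m m' n) j) <= (K * 2 * Sigma * Sigma)%:E)%E.
  have K1 := mulr_ge0 (mulr_ge0 K0 (ler0n R 2)) Sigma_ge0.
  exact: (countable_union_bound P _ _ _ _ _ K1 (fun j => e0 _) Sle
    (fun m => (step2 m).1) (fun m => (step2 m).2)).
split; first by apply: measurableU => //; exact: measurable_infinite_mass.
rewrite /exceptional setUC measureU0//.
- by apply: le_trans PU _; rewrite lee_fin /K; lra.
- exact: measurable_infinite_mass.
- exact: infinite_mass_null int.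
Qed.

Lemma sum_inf_ge (A B : set R) r : A !=set0 -> B !=set0 ->
  (forall x y, A x -> B y -> r <= x + y) -> r <= inf A + inf B.
Proof.
move=> A0 B0 h; rewrite -lerBlDl; apply: lb_le_inf => // y By.
rewrite lerBlDl addrC -lerBlDl; apply: lb_le_inf => // x Ax.
by rewrite lerBlDl addrC h.
Qed.

Lemma net_pen_ge0 t : (\bigcup_m net m) t -> 0 <= pen t.
Proof.
move=> [m _ nt]; have t0 := tau_gt0 _ _ _ z_gt0 a_gt0 c_ge0.
rewrite /net_pen; apply: mulr_ge0.
  exact: mulr_ge0 (ltW z_gt0) (ltW t0).
apply: lb_le_inf.
  by exists (weight (D m) (Delta m)); exists m.
move=> _ [m' _ <-]; have := weight_ge (D m') (Delta m'); rewrite /weight.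
by have := Delta_ge1 m'; lra.
Qed.

Lemma net_pen_le m t : net m t -> pen t <= z * tau * weight (D m) (Delta m).
Proof.
move=> nt; have t0 := tau_gt0 _ _ _ z_gt0 a_gt0 c_ge0.
rewrite /net_pen ler_wpM2l ?(mulr_ge0 (ltW z_gt0) (ltW t0))//.
apply: ge_inf; last by exists m.
exists 0 => _ [m' _ <-]; have := weight_ge (D m') (Delta m'); rewrite /weight.
by have := Delta_ge1 m'; lra.
Qed.

(** The pair [t], [u] falls in the shell whose index is the integer part of
    [(h2 s t + h2 s u) / u0]; there the threshold [z (j + 1) u0] is at most
    [z (h2 s t + h2 s u + u0)]. *)
Lemma not_exceptional_pair n w m m' t u : ~ exceptional n w ->
  net m t -> net m' u ->
  Zreal mu s (obs N w) t u <=
  z * (h2 s t + h2 s u) + z * pair_scale m m' n.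
Proof.
move=> nb nt nu; have t0 := tau_gt0 _ _ _ z_gt0 a_gt0 c_ge0.
set u0 := pair_scale m m' n.
have u00 : 0 < u0.
  have := weight_ge (D m) (Delta m); have := weight_ge (D m') (Delta m').
  have := Delta_ge1 m; have := Delta_ge1 m'; have := ler0n R n => *.
  by rewrite mulr_gt0//; lra.
have tL : L0 t by apply: (SL0 m); have [h _ _] := net_is_net m; exact: h.
have uL : L0 u by apply: (SL0 m'); have [h _ _] := net_is_net m'; exact: h.
have nufin : finite_masses (obs N w).
  by apply: infinite_massP => h; apply: nb; left.
have ht := hloss_ge0 mu s t; have hu := hloss_ge0 mu s u.
set Q := h2 s t + h2 s u; have Q0 : 0 <= Q by rewrite addr_ge0.
have /truncn_itv : 0 <= Q / u0 by rewrite divr_ge0// ltW.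
set j := Num.truncn _ => /andP[jQ Qj].
rewrite ler_pdivlMr// in jQ; rewrite ltr_pdivrMr// in Qj.
rewrite -mulrDr leNgt; apply/negP => Zgt; apply: nb; right.
exists m => //; exists m' => //; exists j => //.
have y2 : j.+1%:R * u0 <= Num.sqrt (j.+2%:R * u0) ^+ 2.
  rewrite sqr_sqrtr; last by rewrite mulr_ge0// ltW.
  by rewrite ler_wpM2r ?(ltW u00)// ler_nat.
exists t; first split=> //.
  rewrite hell_le ?sqrtr_ge0//; try exact: L0m.
  by apply: le_trans y2; apply: le_trans (ltW Qj); rewrite /Q; lra.
exists u; first split=> //.
  rewrite hell_le ?sqrtr_ge0//; try exact: L0m.
  by apply: le_trans y2; apply: le_trans (ltW Qj); rewrite /Q; lra.
rewrite /= (Zstat_Zreal mu)//; try exact: L0m.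
rewrite lte_fin; apply: le_lt_trans Zgt.
by rewrite ler_wpM2l ?(ltW z_gt0)// -natr1 mulrDl mul1r lerD2r.
Qed.

(** The bound for a pair holds for every choice of models containing its two
    points, so it passes to the infima defining the penalties even if these
    are not attained. *)
Lemma not_exceptional_Zreal n w t u : ~ exceptional n w ->
  (\bigcup_m net m) t -> (\bigcup_m net m) u ->
  Zreal mu s (obs N w) t u <=
  z * (h2 s t + h2 s u) + pen t + pen u + z * tau * n%:R.
Proof.
move=> nb [m0 _ nt0] [m0' _ nu0]; have t0 := tau_gt0 _ _ _ z_gt0 a_gt0 c_ge0.
have zt : 0 < z * tau by rewrite mulr_gt0.
suff : (Zreal mu s (obs N w) t u - z * (h2 s t + h2 s u)) / (z * tau) - n%:R <=
    inf [set weight (D m) (Delta m) | m in [set m | net m t]] +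
    inf [set weight (D m) (Delta m) | m in [set m | net m u]].
  by rewrite lerBlDr ler_pdivrMr// /net_pen /weight; lra.
apply: sum_inf_ge; [by exists (weight (D m0) (Delta m0)), m0
  | by exists (weight (D m0') (Delta m0')), m0' |].
move=> _ _ [m /= nt <-] [m' /= nu <-].
rewrite lerBlDr ler_pdivrMr// lerBlDr.
have := not_exceptional_pair _ _ _ _ _ _ nb nt nu.
rewrite /pair_scale; lra.
Qed.

End exceptional.

(** * Integration of the pointwise oracle inequality *)

Section integration.
Context {R : realType} {dO : measure_display} {Omega : measurableType dO}.
Variable P : {measure set Omega -> \bar R}.
Import HBNNSimple.
Local Open Scope ereal_scope.

(** The selected index need not be a measurable function of the outcome.
    The integral of a nonnegative function being a supremum over simple
    functions below it, monotonicity holds without measurability. *)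
Lemma ge0_le_integral_any (f g : Omega -> \bar R) :
  (forall w, 0 <= f w) -> (forall w, f w <= g w) ->
  \int[P]_w f w <= \int[P]_w g w.
Proof.
move=> f0 fg; rewrite !ge0_integralTE//; last first.
  by move=> w; exact: le_trans (f0 w) (fg w).
by apply: le_ereal_sup => _ [h /= hf <-]; exists h => // w; exact: le_trans (fg w).
Qed.

Definition hit_count (A : nat -> set Omega) (w : Omega) : \bar R :=
  \sum_(n <oo) (\1_(A n) w)%:E.

Lemma hit_count_ge0 A w : 0 <= hit_count A w.
Proof. by apply: nneseries_ge0 => n _ _; rewrite lee_fin. Qed.

(** Were the outcome in each of the sets with index at most the count, there
    would be more of them than the count. *)
Lemma hit_count_ge A w : hit_count A w < +oo ->
  exists2 n, ~ A n w & n%:R%:E <= hit_count A w.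
Proof.
move=> fin; apply: contrapT => h.
have allA n : n%:R%:E <= hit_count A w -> A n w.
  by move=> hn; apply: contrapT => nA; apply: h; exists n.
have gfin : hit_count A w \is a fin_num by rewrite ge0_fin_numE ?hit_count_ge0.
have [g ge] : exists g, hit_count A w = g%:E by exists (fine (hit_count A w)); rewrite fineK.
have g0 : (0 <= g)%R by rewrite -lee_fin -ge hit_count_ge0.
have /andP[tg gt] := truncn_itv g0.
suff : ((Num.truncn g).+1%:R)%:E <= hit_count A w by rewrite ge lee_fin leNgt gt.
apply: (@le_trans _ _ (\sum_(i < (Num.truncn g).+1) (\1_(A i) w)%:E)).
  rewrite (eq_bigr (fun=> 1)) => [|i _].
    by rewrite sumEFin sumr_const card_ord.
  rewrite indicE mem_set//; apply: allA; rewrite ge lee_fin (le_trans _ tg)//.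
  by rewrite ler_nat -ltnS.
rewrite -(big_mkord xpredT (fun i => (\1_(A i) w)%:E)).
by apply: nneseries_lim_ge => i _; rewrite lee_fin.
Qed.

Lemma measurable_hit_count A : (forall n, measurable (A n)) ->
  measurable_fun [set: Omega] (hit_count A).
Proof.
move=> mA; apply: ge0_emeasurable_sum => // n _.
exact/measurable_EFinP/measurable_indic.
Qed.

Lemma integral_hit_count A (K : R) : (0 <= K)%R -> (forall n, measurable (A n)) ->
  (forall n, P (A n) <= (K * expR (- n%:R))%:E) ->
  \int[P]_w hit_count A w <= (2 * K)%:E.
Proof.
move=> K0 mA PA; rewrite integral_nneseries//; last first.
  by move=> n; exact/measurable_EFinP/measurable_indic.
apply: (@le_trans _ _ (\sum_(n <oo) K%:E * (expR (- n%:R))%:E)).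
  apply: lee_nneseries => n _; first by rewrite integral_ge0// => w _; rewrite lee_fin.
  by rewrite integral_indic// setIT.
rewrite nneseriesZl; last by move=> n _; rewrite lee_fin expR_ge0.
rewrite mulrC EFinM; apply: lee_wpmul2l; first by rewrite lee_fin.
rewrite nneseries_esumT; first exact: esum_expRN_le2.
by move=> n; rewrite lee_fin expR_ge0.
Qed.

End integration.

Lemma measurable_countable_fun {R : realType} {dO : measure_display}
    {Omega : measurableType dO} (I : countType) (m : Omega -> I) (f : I -> R) :
  (forall i, measurable [set w | m w = i]) ->
  measurable_fun [set: Omega] (f \o m).
Proof.
move=> mm _ B mB; rewrite setTI.
rewrite (_ : _ @^-1` B = \bigcup_(i in [set i | B (f i)]) [set w | m w = i]).
  rewrite bigcup_mkcond; apply: countable_bigcupT_measurable => // i.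
  by case: ifP.
apply/seteqP; split=> [w Bw|w [i Bi /= mi]]; first by exists (m w).
by rewrite mi.
Qed.

(** In the application [I] is the expectation of [max D Delta], which is at least
    1 since [Delta >= 1]; a remainder proportional to [tau] is then dominated
    by [tau * I]. *)
Lemma absorb_remainder {R : realType} (A I G : \bar R) (F tau K : R) :
  (0 <= A)%E -> (1 <= I)%E -> (G <= K%:E)%E -> 0 <= F -> 0 <= tau -> 0 <= K ->
  (F%:E * (A + (tau%:E * I + tau%:E * G)) <=
   (F * (1 + K))%:E * (A + tau%:E * I))%E.
Proof.
move=> A0 I1 GK F0 tau0 K0.
have I0 : (0 <= I)%E by exact: le_trans I1.
have tI0 : (0 <= tau%:E * I)%E by rewrite mule_ge0.
rewrite EFinM -muleA; apply: lee_wpmul2l; first by rewrite lee_fin.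
rewrite EFinD ge0_muleDl ?lee_fin// mul1e addeA leeD2l//.
apply: (@le_trans _ _ (K%:E * (tau%:E * I))%E); last first.
  by apply: lee_wpmul2l; rewrite ?lee_fin// leeDr.
rewrite muleCA; apply: lee_wpmul2l; first by rewrite lee_fin.
by apply: le_trans GK _; rewrite lee_pemulr.
Qed.

Theorem corollary3 (R : realType) (z M b Sigma : R)
    (hz : 0 < z < 1 - (Num.sqrt 2)^-1) (hM : 0 < M) (hb : 0 <= b) :
  exists C : R, 0 < C /\
  forall (k : nat) (hk : (0 < k)%N)
    (dO : measure_display) (Omega : measurableType dO) (P : probability Omega R)
    (d : 'I_k -> measure_display) (X : forall i, measurableType (d i))
    (mu : mtuple R X) (N : forall i, R.-ker Omega ~> X i)
    (s : ftuple R X) (L0 : set (ftuple R X)),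
    L0 `<=` tuple_class mu -> L0 s ->
    independent_measures P N -> has_intensity P N mu s ->
  forall a c : R, 0 < a -> 0 <= c ->
  let tau := tau_of z a c in
    (forall y xi : R, 0 < y -> 0 < xi ->
       (ereal_sup [set P [set w | xi%:E < Zstat mu s (obs N w) t t']
                  | t in hball mu L0 s y & t' in hball mu L0 s y]
        <= (b * expR (- (a * xi ^+ 2 / (y ^+ 2 + c * xi))))%:E)%E) ->
  forall (I : countType) (S : I -> set (ftuple R X)) (Delta : I -> R),
    (forall m, S m !=set0 /\ S m `<=` L0) ->
    (forall m, 1 <= Delta m) ->
    (\esum_(m in [set: I]) (expR (- Delta m))%:E = Sigma%:E)%E ->
  forall (D : I -> R) (net : I -> set (ftuple R X)),
    (forall m, 0 <= D m) ->
    (forall m,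
       is_net mu L0 M (eta_of (D m) * Num.sqrt tau) (D m) (net m) (S m)) ->
  forall (L : countType) (shat : L -> mtuple R X -> ftuple R X)
    (mhat : L -> mtuple R X -> I),
    (forall l, is_estimator mu L0 (shat l)) ->
    (forall l nu, (\bigcup_m S m) (shat l nu)) ->
    (forall l m, mtuple_sigma [set nu | mhat l nu = m]) ->
    (forall l nu, S (mhat l nu) (shat l nu)) ->
  forall lhat : Omega -> L,
    (forall w,
       indirect_selected mu (net_pen z tau net D Delta) tau (obs N w)
         (\bigcup_m net m) (fun l => shat l (obs N w)) (lhat w)) ->
  (\int[P]_w H2 mu s (shat (lhat w) (obs N w)) <=
   C%:E * ereal_inf
     [set \int[P]_w H2 mu s (shat l (obs N w)) +
          tau%:E * \int[P]_w
            (Num.max (D (mhat l (obs N w))) (Delta (mhat l (obs N w))))%:E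
     | l in [set: L]])%E.
Proof.
have [z0 zlt] := andP hz.
have gap0 : 0 < test_gap z by rewrite /test_gap subr_gt0.
pose F := oracle_factor z.
have F0 : 0 < F by rewrite /F /oracle_factor addr_gt0// divr_gt0.
pose K := 2 * (b * M ^+ 2) * Sigma ^+ 2.
have K0 : 0 <= K by rewrite mulr_ge0 ?sqr_ge0// mulr_ge0// mulr_ge0 ?sqr_ge0.
have F12 : 0 < 12 * F by rewrite mulr_gt0.
have K1 : 0 < 1 + 2 * K by lra.
have C0 := mulr_gt0 F12 K1.
exists (12 * F * (1 + 2 * K)); split=> //.
move=> k hk dO Omega P d X mu N s L0 L0m L0s _ int a c a0 c0 tau tail.
move=> I S Delta SL0 Dl1 Dsum D net D0 hnet L shat mhat est estS mm mS lhat sel.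
have tau0 : 0 < tau by exact: tau_gt0.
have SL0' m : S m `<=` L0 by have [] := SL0 m.
have netL0 : \bigcup_m net m `<=` L0.
  by move=> t [m _ nt]; apply: (SL0' m); have [h _ _] := hnet m; exact: h.
have shL0 l nu : L0 (shat l nu) by have [m _ h] := estS l nu; exact: (SL0' m).
pose pen := net_pen z tau net D Delta.
pose A := exceptional mu N s z a c I net Delta D.
have AP n : measurable (A n) /\ (P (A n) <= (K * expR (- n%:R))%:E)%E.
  exact: (exceptional_le P mu N s L0 z M b a c L0m L0s int z0 hM hb a0 c0 tail
    I S net Delta D Sigma SL0' Dl1 Dsum D0 hnet n).
pose G : Omega -> \bar R := hit_count A.
pose x l w := Num.max (D (mhat l (obs N w))) (Delta (mhat l (obs N w))).
have x1 l w : 1 <= x l w by rewrite le_max Dl1 orbT.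
have pointwise l w : (H2 mu s (shat (lhat w) (obs N w)) <=
    (12 * F)%:E * ((hloss mu s (shat l (obs N w)))%:E +
      (tau%:E * (x l w)%:E + tau%:E * G w)))%E.
  (* If infinitely many exceptional events occur, the bound is infinite. *)
  have [Gy|Gfin] := eqVneq (G w) +oo%E.
    rewrite Gy gt0_muley ?lte_fin// !addey//.
    by rewrite gt0_muley ?leey// lte_fin.
  have [|n nA nG] := @hit_count_ge R _ _ A w; first by rewrite ltey.
  have nufin : finite_masses (obs N w).
    by apply: infinite_massP => h; apply: nA; left.
  set nu := obs N w in nufin *.
  pose m := mhat l nu.
  have [_ /(_ _ (mS l nu))[t nt ht] _] := hnet m.
  have tnet : (\bigcup_m net m) t by exists m.
  have eta0 : 0 <= eta_of (D m) * Num.sqrt tau.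
    by rewrite mulr_ge0 ?sqrtr_ge0.
  have cl u : L0 u -> tuple_class mu u by exact: L0m.
  rewrite hell_le// in ht; try by apply: cl; auto.
  rewrite exprMn (sqr_sqrtr (ltW tau0)) in ht.
  have pt := net_pen_le z a c z0 a0 c0 _ net Delta D Dl1 m t nt.
  have orc := indirect_selected_oracle mu nu s (\bigcup_m net m) pen z
    (z * tau * n%:R) tau nufin (cl _ L0s) (subset_trans netL0 L0m)
    (net_pen_ge0 z a c z0 a0 c0 _ net Delta D Dl1) gap0
    (mulr_ge0 (mulr_ge0 (ltW z0) (ltW tau0)) (ler0n _ n)) (ltW tau0)
    (fun t u => not_exceptional_Zreal mu N s L0 z M a c L0m L0s z0 a0 c0
      _ S net Delta D SL0' Dl1 hnet n w t u nA)
    L (fun l => shat l nu) (lhat w) l t (fun l => cl _ (shL0 l nu)) tnet (sel w).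
  rewrite H2_hloss; try by apply: cl; auto.
  apply: (@le_trans _ _ ((12 * F) * (hloss mu s (shat l nu) +
      (tau * x l w + tau * n%:R)))%:E).
    rewrite lee_fin; apply: le_trans orc _.
    rewrite -/F [12 * F]mulrC -[F * 12 * _]mulrA ler_wpM2l ?(ltW F0)//.
    have Dx : D m <= x l w by rewrite le_max lexx.
    have Dlx : Delta m <= x l w by rewrite le_max lexx orbT.
    have etax : eta_of (D m) ^+ 2 <= 2 * x l w.
      rewrite eta_sq ler_wpM2l// ge_max Dx/=.
      by apply: le_trans (x1 l w); lra.
    have h0 := hloss_ge0 mu s (shat l nu).
    have z1 : z <= 1 by have := gap0; rewrite /test_gap => g;
      have := sqrtr_ge0 (2 : R); rewrite -invr_ge0; lra.
    have wx : weight (D m) (Delta m) <= 9 * x l w by rewrite /weight; lra.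
    have w0 := weight_ge (D m) (Delta m); have Dl := Dl1 m.
    have e1 : eta_of (D m) ^+ 2 * tau <= 2 * x l w * tau.
      by rewrite ler_wpM2r ?(ltW tau0).
    have e2 : z * tau * weight (D m) (Delta m) <= tau * (9 * x l w).
      apply: (@le_trans _ _ (tau * weight (D m) (Delta m))).
        by rewrite -mulrA ler_piMl// mulr_ge0 ?(ltW tau0)//; lra.
      by rewrite ler_wpM2l ?(ltW tau0).
    have e3 : tau * 1 <= tau * x l w by rewrite ler_wpM2l ?(ltW tau0).
    have tn0 := mulr_ge0 (ltW tau0) (ler0n R n).
    have e4 : z * (tau * n%:R) <= tau * n%:R by rewrite ler_piMl.
    rewrite -/tau -/pen in pt.
    move: (pen t) (x l w) (weight _ _) (eta_of _ ^+ 2)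
      (hloss mu s (shat l nu)) (hloss mu (shat l nu) t)
      h0 pt ht e1 e2 e3 e4 tn0.
    move=> p y q v h g h0 pt ht e1 e2 e3 e4 tn0; lra.
  rewrite EFinM; apply: lee_wpmul2l; first by rewrite lee_fin (ltW F12).
  rewrite !EFinD !EFinM leeD2l// leeD2l//.
  by apply: lee_wpmul2l; rewrite ?lee_fin// ltW.
have intG : (\int[P]_w G w <= (2 * K)%:E)%E.
  exact: integral_hit_count K0 (fun n => (AP n).1) (fun n => (AP n).2).
have mG : measurable_fun [set: Omega] G.
  by apply: measurable_hit_count => n; exact: (AP n).1.
rewrite -lee_pdivrMl//; apply: le_ereal_inf_tmp => _ [l _ <-].
rewrite lee_pdivrMl//; apply: le_trans (ge0_le_integral_any P _ _ _ (pointwise l)) _.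
  by move=> w; exact: H2_ge0.
have tauE : (0 <= tau%:E)%E by rewrite lee_fin ltW.
have mh : measurable_fun [set: Omega]
    (fun w => (hloss mu s (shat l (obs N w)))%:E).
  apply/measurable_EFinP.
  exact: measurable_estimator_loss L0m L0s (est l) (shL0 l).
have mx : measurable_fun [set: Omega] (fun w => (x l w)%:E).
  apply/measurable_EFinP.
  apply: (measurable_countable_fun I (fun w => mhat l (obs N w))
    (fun i => Num.max (D i) (Delta i))) => i.
  exact: (measurable_obs_preimage N _ (mm l i)).
have h0 w : (0 <= (hloss mu s (shat l (obs N w)))%:E)%E by rewrite lee_fin hloss_ge0.
have x0 w : (0 <= (x l w)%:E)%E by rewrite lee_fin (le_trans ler01)// x1.
have G0 w : (0 <= G w)%E by exact: hit_count_ge0.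
have mtx := measurable_funeM tau%:E mx. have mtG := measurable_funeM tau%:E mG.
have tx0 w : (0 <= tau%:E * (x l w)%:E)%E by exact: mule_ge0.
have tG0 w : (0 <= tau%:E * G w)%E by exact: mule_ge0.
set rhs := leRHS.
rewrite ge0_integralZl_EFin//; last 3 first.
- by move=> w _; rewrite !adde_ge0.
- by apply: emeasurable_funD => //; exact: emeasurable_funD.
- exact: ltW.
rewrite ge0_integralD//; last 2 first.
- by move=> w _; rewrite adde_ge0.
- exact: emeasurable_funD.
rewrite ge0_integralD// !ge0_integralZl_EFin ?(ltW tau0)// /rhs.
have -> : (\int[P]_w (hloss mu s (shat l (obs N w)))%:E =
    \int[P]_w H2 mu s (shat l (obs N w)))%E.
  by apply: eq_integral => w _; rewrite H2_hloss//; exact: L0m.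
have I1 : (1 <= \int[P]_w (x l w)%:E)%E.
  apply: le_trans (ge0_le_integral_any P (cst 1%E) _ _ _); last 2 first.
  - by move=> w; rewrite lee_fin.
  - by move=> w; rewrite lee_fin x1.
  by rewrite integral_cst// mul1e -[leLHS](@probability_setT _ _ _ P).
have loss0 : (0 <= \int[P]_w H2 mu s (shat l (obs N w)))%E.
  by apply: integral_ge0 => w _; exact: H2_ge0.
have K20 : 0 <= 2 * K by rewrite mulr_ge0.
exact: (absorb_remainder _ _ _ _ _ _ loss0 I1 intG (ltW F12) (ltW tau0) K20).
Qed.
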